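(* Let $A$ be a nontrivial closed class of decision tables from $\mathcal M_2^\infty$, let $\psi$ be a bounded complexity measure, and suppose $\mathcal H^\infty_{\psi,A}$ is everywhere defined. Then there exists a polynomial $p_0$ with $\mathcal H^\infty_{\psi,A}(n)\le p_0(n)$ for all $n\in\omega$ if and only if there exist polynomials $p_1,p_2,p_3$ such that, for all $n\in\omega$, $Z_{\psi,A}(n)\le p_1(n)$, $G_{\psi,A}(n)\le p_2(n)$ and $L_{\psi,A}(n)\le 2^{p_3(n)}$ (in particular these three functions are defined everywhere).
   Context: Notation: $\omega=\{0,1,2,\dots\}$; $\mathcal P(\omega)$ is the set of nonempty finite subsets of $\omega$; $E_2=\{0,1\}$. $P=\{f_i:i\in\omega\}$ is a set of attributes, $f_i\neq f_j$ for $i\ne j$. Decision tables: $\mathcal M_2^\infty$ is the set of rectangular tables filled with numbers from $E_2$, whose columns are labeled with pairwise different attributes from $P$, whose rows are pairwise different, and each row of which is labeled with a set from $\mathcal P(\omega)$ (its set of decisions). The empty table (no rows) is denoted $\Lambda$ and belongs to $\mathcal M_2^\infty$. For $T\in\mathcal M_2^\infty$: $\Delta(T)$ is the set of rows; $\Pi(T)$ is the intersection of the decision sets of all rows (common decisions); $\mathrm{At}(T)$ is the set of attributes labeling columns; $N(T)$ is the number of rows. For nonempty $T$, $\Omega_2(T)$ is the set of finite words (including the empty word $\lambda$) over the alphabet $\{(f_i,\delta):f_i\in\mathrm{At}(T),\delta\in E_2\}$; for $\alpha=(f_{i_1},\delta_1)\cdots(f_{i_m},\delta_m)$, $T\alpha$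 is the subtable of $T$ consisting of the rows having value $\delta_j$ in the column $f_{i_j}$ for all $j$, and $T\lambda=T$. Operations: for $D\subseteq\mathrm{At}(T)$, $I(D,T)$ is obtained from $T$ by deleting the columns labeled with attributes from $D$ and, in each group of rows coinciding on the remaining columns, keeping only the first row; $I(\mathrm{At}(T),T)=\Lambda$. For $\nu:E_2^{|\mathrm{At}(T)|}\to\mathcal P(\omega)$, $J(\nu,T)$ is obtained by replacing the decision set of each row $\bar\delta$ by $\nu(\bar\delta)$. $[T]=\{J(\nu,I(D,T)):D\subseteq\mathrm{At}(T),\ \nu:E_2^{|\mathrm{At}(T)\setminus D|}\to\mathcal P(\omega)\}$; for nonempty $A\subseteq\mathcal M_2^\infty$, $[A]=\bigcup_{T\in A}[T]$. $A$ is a closed class if $[A]=A$; nontrivial if it contains a nonempty table. Decision trees: a $2$-decision tree is a finite directed rooted tree with at least two nodes in which the root and the edges leaving the root are unlabeled, each terminal node is labeled with a decision from $\omega$, and each other node is labeled with an attribute from $P$, each edge leaving such a node being labeled with a number from $E_2$. $\mathrm{At}(\Gamma)$ is the set of attributes labeling nodes of $\Gamma$. For a complete path $\tau=v_1,d_1,\dots,v_m,d_m,v_{m+1}$ (from the root to a terminal node), $\pi(\tau)=\lambda$ if $m=1$, and otherwise $\pi(\tau)=(f_{i_2},\delta_2)\cdots(f_{i_m},\delta_m)$ where $v_j$ is labeled $f_{i_j}$ and $d_j$ is labeled $\delta_j$; $T(\tau)=T\pi(\tau)$. For $T\ne\Lambda$, a nondeterministic decision tree for $T$ is a $2$-decision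 tree $\Gamma$ with $\mathrm{At}(\Gamma)\subseteq\mathrm{At}(T)$ such that every row of $T$ belongs to $T(\tau)$ for some complete path $\tau$, and for every complete path $\tau$ either $T(\tau)=\Lambda$ or the decision at the terminal node of $\tau$ belongs to $\Pi(T(\tau))$. A deterministic decision tree for $T$ is a nondeterministic decision tree for $T$ in which, additionally, exactly one edge leaves the root and the edges leaving any node that is neither the root nor terminal are labeled with pairwise different numbers. Complexity measures: a partially bounded complexity measure is a function $\psi:P^*\to\omega$ on finite words over $P$ such that for all words $\alpha_1,\alpha_2$: $\psi(\alpha_1)=0$ iff $\alpha_1=\lambda$; $\psi(\alpha_1)$ is invariant under permutation of letters; $\psi(\alpha_1)\le\psi(\alpha_1\alpha_2)$; $\psi(\alpha_1\alpha_2)\le\psi(\alpha_1)+\psi(\alpha_2)$. It is bounded if in addition $\psi(\alpha)\ge|\alpha|$ for all $\alpha$. $\psi$ is extended to words $(f_{i_1},\delta_1)\cdots(f_{i_m},\delta_m)$ by $\psi(f_{i_1}\cdots f_{i_m})$ ($\psi(\lambda)=0$). For a $2$-decision tree $\Gamma$, $\psi(\Gamma)=\max_\tau\psi(\pi(\tau))$ over complete paths. For $T\ne\Lambda$, $\psi^d(T)$ (resp. $\psi^a(T)$) is the minimum of $\psi(\Gamma)$ over deterministic (resp. nondeterministic) decision trees $\Gamma$ for $T$; $\psi^d(\Lambda)=\psi^a(\Lambda)=0$. Parameters: $m_\psi(T)=\max\{\psi(f_i):f_i\in\mathrm{At}(T)\}$, $m_\psi(\Lambda)=0$. A table $Q\in\mathcal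 M_2^\infty$ is complete if $N(Q)=2^{|\mathrm{At}(Q)|}$; $Z(T)$ is the maximum number of columns of a complete table in $[T]$ if such tables exist, and $0$ otherwise; $Z(\Lambda)=0$. A word $\alpha\in\Omega_2(T)$ is annihilating for $T$ if $T\alpha=\Lambda$ and $\alpha$ contains no two letters $(f_i,\delta),(f_i,\sigma)$ with $\delta\ne\sigma$; it is irreducible if no word obtained from $\alpha$ by deleting some (at least one) letters is annihilating; $G(T)$ is the maximum length of an irreducible annihilating word for $T$ if one exists, and $0$ otherwise; $G(\Lambda)=0$. For $T\ne\Lambda$, $n\in\omega$: $\Omega_2^n(T)=\{\alpha\in\Omega_2(T):\psi(\alpha)\le n\}$; a finite $U\subseteq\Omega_2^n(T)$ is a $(\psi,n)$-cover of $T$ if $\bigcup_{\alpha\in U}\Delta(T\alpha)=\Delta(T)$, irreducible if no proper subset is a $(\psi,n)$-cover; $l_\psi(T,n)$ is the maximum cardinality of an irreducible $(\psi,n)$-cover of $T$; $l_\psi(\Lambda,n)=0$. Class functions ($n\in\omega$): $A_\psi(n)=\{T\in A:m_\psi(T)\le n\}$. $Z_{\psi,A}(n)$ is undefined if $\{Z(T):T\in A_\psi(n)\}$ is infinite, else its maximum; $G_{\psi,A}(n)$ is undefined if $\{G(T):T\in A_\psi(n)\}$ is infinite, else its maximum; $L_{\psi,A}(n)$ is undefined if $\{l_\psi(T,n):T\in A\}$ is infinite, else its maximum; $\mathcal H^\infty_{\psi,A}(n)$ is undefined if $\{\psi^d(T):T\in A,\psi^a(T)\le n\}$ is infinite, else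 its maximum. *)

(* Defs.v *)
From HB Require Import structures.
From mathcomp Require Import all_boot all_order all_algebra.
Set Implicit Arguments. Unset Strict Implicit. Unset Printing Implicit Defensive.

(* Attribute f_i is represented by the index i : nat.  A table is a list of
   column attributes and a list of rows; each row is a vector of values in
   E_2 = bool (one per column) together with its decision set, a nonempty
   finite subset of omega represented canonically as a strictly increasing
   nonempty list. *)
Record table := Table { cols : seq nat; rows : seq (seq bool * seq nat) }.

Definition dec_canon (s : seq nat) : bool := sorted ltn s && (s != [::]).

(* Membership in M_2^infty.  Tables without rows are the empty table Lambda
   (which has no columns); a nonempty table has at least one column. *)
Definition wf_table (T : table) : bool :=
  [&& uniq (cols T),
      all (fun r => size r.1 == size (cols T)) (rows T),
      uniq (map fst (rows T)),
      all (fun r => dec_canon r.2) (rows T) &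
      ((rows T == [::]) == (cols T == [::]))].

Definition Lambda : table := Table [::] [::].

Definition is_empty_table (T : table) : bool := rows T == [::].

Definition val_at (T : table) (r : seq bool) (i : nat) : bool :=
  nth false r (index i (cols T)).

Definition letter := (nat * bool)%type.
Definition word := seq letter.

Definition matches (T : table) (r : seq bool) (a : word) : bool :=
  all (fun l => val_at T r l.1 == l.2) a.

Definition rows_of (T : table) (a : word) := [seq r <- rows T | matches T r.1 a].

Fixpoint keep_first (seen : seq (seq bool)) (s : seq (seq bool * seq nat)) :=
  match s with
  | [::] => [::]
  | x :: s' => if x.1 \in seen then keep_first seen s'
               else x :: keep_first (x.1 :: seen) s'
  end.

Definition opI (D : seq nat) (T : table) : table :=
  let keep := [seq i <- cols T | i \notin D] in
  if keep == [::] then Lambda else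
  Table keep
    (keep_first [::] [seq ([seq val_at T r.1 i | i <- keep], r.2) | r <- rows T]).

Definition opJ (nu : seq bool -> seq nat) (T : table) : table :=
  Table (cols T) [seq (r.1, nu r.1) | r <- rows T].

Definition in_closure (T Q : table) : Prop :=
  exists (D : seq nat) (nu : seq bool -> seq nat),
    {subset D <= cols T} /\ (forall s, dec_canon (nu s)) /\ Q = opJ nu (opI D T).

Definition closed_class (A : table -> Prop) : Prop :=
  (forall T, A T -> wf_table T) /\ (exists T, A T) /\
  (forall Q, (exists T, A T /\ in_closure T Q) <-> A Q).

Definition nontrivial (A : table -> Prop) : Prop :=
  exists T, A T /\ ~~ is_empty_table T.

(* A non-root node is either terminal (labeled with a decision) or labeled
   with an attribute and has a nonempty list of outgoing edges labeled in E_2.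
   A tree is the nonempty list of children of the (unlabeled) root. *)
Inductive node := Leaf of nat | Node of nat & seq (bool * node).
Definition dtree := seq node.

Fixpoint node_wf (v : node) : bool :=
  match v with
  | Leaf _ => true
  | Node _ ch => (~~ nilp ch) &&
      (fix aux (l : seq (bool * node)) := match l with
        | [::] => true | (_, c) :: l' => node_wf c && aux l' end) ch
  end.

Fixpoint node_det (v : node) : bool :=
  match v with
  | Leaf _ => true
  | Node _ ch => uniq (map fst ch) &&
      (fix aux (l : seq (bool * node)) := match l with
        | [::] => true | (_, c) :: l' => node_det c && aux l' end) ch
  end.

Fixpoint node_attrs (v : node) : seq nat :=
  match v with
  | Leaf _ => [::]
  | Node i ch => i ::
      (fix aux (l : seq (bool * node)) := match l with
        | [::] => [::] | (_, c) :: l' => node_attrs c ++ aux l' end) ch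
  end.

Fixpoint node_paths (v : node) : seq (word * nat) :=
  match v with
  | Leaf d => [:: ([::], d)]
  | Node i ch =>
      (fix aux (l : seq (bool * node)) := match l with
        | [::] => [::]
        | (b, c) :: l' => [seq ((i, b) :: p.1, p.2) | p <- node_paths c] ++ aux l'
        end) ch
  end.

Definition tree_wf (G : dtree) : bool := (~~ nilp G) && all node_wf G.
Definition tree_attrs (G : dtree) : seq nat := flatten (map node_attrs G).
Definition tree_paths (G : dtree) : seq (word * nat) := flatten (map node_paths G).
Definition tree_det (G : dtree) : bool := (size G == 1) && all node_det G.

Definition nondet_tree_for (T : table) (G : dtree) : Prop :=
  [/\ tree_wf G, {subset tree_attrs G <= cols T},
      (forall r, r \in rows T -> exists2 p, p \in tree_paths G & matches T r.1 p.1) &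
      (forall p, p \in tree_paths G ->
         forall r, r \in rows_of T p.1 -> p.2 \in r.2)].

Definition det_tree_for (T : table) (G : dtree) : Prop :=
  nondet_tree_for T G /\ tree_det G.

Definition measure_type := seq nat -> nat.

Definition partially_bounded (psi : measure_type) : Prop :=
  [/\ forall a, (psi a == 0) = (a == [::]),
      forall a b, perm_eq a b -> psi a = psi b,
      forall a b, psi a <= psi (a ++ b) &
      forall a b, psi (a ++ b) <= psi a + psi b].

Definition bounded_measure (psi : measure_type) : Prop :=
  partially_bounded psi /\ forall a, size a <= psi a.

Definition psi_w (psi : measure_type) (a : word) : nat := psi (map fst a).

Definition psi_tree (psi : measure_type) (G : dtree) : nat :=
  \max_(p <- tree_paths G) psi_w psi p.1.

Definition psi_d_is (psi : measure_type) (T : table) (k : nat) : Prop :=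
  if is_empty_table T then k = 0 else
  (exists2 G, det_tree_for T G & psi_tree psi G = k) /\
  (forall G, det_tree_for T G -> k <= psi_tree psi G).

Definition psi_a_is (psi : measure_type) (T : table) (k : nat) : Prop :=
  if is_empty_table T then k = 0 else
  (exists2 G, nondet_tree_for T G & psi_tree psi G = k) /\
  (forall G, nondet_tree_for T G -> k <= psi_tree psi G).

Definition m_psi (psi : measure_type) (T : table) : nat :=
  \max_(i <- cols T) psi [:: i].

Definition complete (Q : table) : bool := size (rows Q) == 2 ^ size (cols Q).

Definition Z_is (T : table) (z : nat) : Prop :=
  if is_empty_table T then z = 0 else
  (exists Q, [/\ in_closure T Q, complete Q, size (cols Q) = z &
     forall Q', in_closure T Q' -> complete Q' -> size (cols Q') <= z])
  \/ ((forall Q, in_closure T Q -> ~~ complete Q) /\ z = 0).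

Definition in_Omega (T : table) (a : word) : bool := all (fun l => l.1 \in cols T) a.

Definition annihilating (T : table) (a : word) : Prop :=
  [/\ in_Omega T a, rows_of T a = [::] &
      forall i b c, (i, b) \in a -> (i, c) \in a -> b = c].

(* a word obtained by deleting at least one letter = a subsequence of smaller size *)
Definition irreducible_ann (T : table) (a : word) : Prop :=
  annihilating T a /\
  forall b : word, subseq b a -> size b < size a -> ~ annihilating T b.

Definition G_is (T : table) (g : nat) : Prop :=
  if is_empty_table T then g = 0 else
  (exists a, [/\ irreducible_ann T a, size a = g &
     forall b, irreducible_ann T b -> size b <= g])
  \/ ((forall a, ~ irreducible_ann T a) /\ g = 0).

(* (psi,n)-covers: finite sets of words, represented as duplicate-free lists *)
Definition cover (psi : measure_type) (T : table) (n : nat) (U : seq word) : Prop :=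
  (forall a, a \in U -> in_Omega T a /\ psi_w psi a <= n) /\
  (forall r, r \in rows T -> exists2 a, a \in U & matches T r.1 a).

Definition irreducible_cover psi T n (U : seq word) : Prop :=
  uniq U /\ cover psi T n U /\
  forall U', uniq U' -> {subset U' <= U} -> ~ {subset U <= U'} -> ~ cover psi T n U'.

Definition l_is (psi : measure_type) (T : table) (n m : nat) : Prop :=
  if is_empty_table T then m = 0 else
  exists U, [/\ irreducible_cover psi T n U, size U = m &
    forall U', irreducible_cover psi T n U' -> size U' <= m].

Definition defined (S : nat -> Prop) : Prop :=
  exists s : seq nat, forall k, S k <-> k \in s.

Definition value (S : nat -> Prop) (m : nat) : Prop :=
  [/\ defined S, S m & forall k, S k -> k <= m].

Definition Z_set psi (A : table -> Prop) (n : nat) : nat -> Prop :=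
  fun z => exists T, [/\ A T, m_psi psi T <= n & Z_is T z].
Definition G_set psi (A : table -> Prop) (n : nat) : nat -> Prop :=
  fun g => exists T, [/\ A T, m_psi psi T <= n & G_is T g].
Definition L_set psi (A : table -> Prop) (n : nat) : nat -> Prop :=
  fun m => exists T, A T /\ l_is psi T n m.
Definition H_set psi (A : table -> Prop) (n : nat) : nat -> Prop :=
  fun h => exists T, [/\ A T, (exists2 a, psi_a_is psi T a & a <= n) & psi_d_is psi T h].

(* Main.v *)
Require Import Defs.
From HB Require Import structures.
From mathcomp Require Import all_boot all_order all_algebra.
From mathcomp Require Import zify.
From Stdlib Require Import Classical_Prop.
Set Implicit Arguments. Unset Strict Implicit. Unset Printing Implicit Defensive.

(* A cover U of a table T by words of complexity at most n becomes a problem of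
   nondeterministic complexity at most n when each row is labelled with the
   indices of the members of U that it satisfies; hence, if H(n) <= h, a
   deterministic tree of complexity at most h finds for each row of T a member
   of U that it satisfies.

   Necessity of the three bounds applies this to suitable covers.  An
   irreducible cover forces one leaf per word, so L(n) <= 2^h.  For an
   irreducible annihilating word, the negations of its letters form a cover;
   an adversary answering according to the word delays the tree by all letters
   but one, so G(n) <= h + 1.  In a complete table with w(w + 2) columns, read
   as w + 2 lines of w bits, two of the lines descend at the same position;
   words of length 4 certify this, but an adversary answering with injectively
   chosen thermometer codes forces depth w.  With H(4n) <= h this gives
   Z(n) < (h + 1)(h + 3).

   Conversely, given a nondeterministic tree of complexity at most n for T, take
   an irreducible subcover of its path words and restrict T to the attributes
   that occur in it.  By the Sauer-Shelah lemma the restriction has at most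
   (n 2^p3 + 1)^Z rows, and a query round of at most G + n attributes either
   finds the answer or halves the number of rows. *)

(** * Extremal elements of sets of natural numbers *)

Lemma ex_least (P : nat -> Prop) :
  (exists n, P n) -> exists2 m, P m & forall k, P k -> m <= k.
Proof.
case=> n; elim/ltn_ind: n => n IHn Pn.
have [[k lt_kn Pk]|noP] := classic (exists2 k, k < n & P k); first exact: IHn lt_kn Pk.
exists n => // k Pk; rewrite leqNgt; apply/negP => lt_kn; by apply: noP; exists k.
Qed.

(** Reflection [j |-> B - j] turns a greatest element into a least one. *)
Lemma ex_greatest (P : nat -> Prop) B :
  (exists n, P n) -> (forall k, P k -> k <= B) ->
  exists2 m, P m & forall k, P k -> k <= m.
Proof.
move=> [n Pn] leB.
have [|j [le_jB PBj] minj] := @ex_least (fun j => j <= B /\ P (B - j)).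
  by exists (B - n); rewrite leq_subr subKn ?leB.
exists (B - j) => // k Pk; have le_kB := leB k Pk.
by rewrite leq_subRL // addnC -leq_subRL // minj // leq_subr subKn.
Qed.

(** The list that [defined] asks for is built by induction on the bound, deciding membership
    classically. Claims about class functions thus reduce to a nonempty set and an upper bound. *)
Lemma bounded_value (S : nat -> Prop) B :
  (exists k, S k) -> (forall k, S k -> k <= B) -> exists2 m, value S m & m <= B.
Proof.
move=> exS leB; have [m Sm maxm] := ex_greatest exS leB.
exists m; last exact: leB.
split=> //.
have [s Ds]: exists s : seq nat, forall k, k \in s <-> S k /\ k < B.+1.
  elim: B.+1 => [|b [s Ds]]; first by exists [::] => k; split=> // -[].
  have [Sb|nSb] := classic (S b).
    exists (b :: s) => k; rewrite inE ltnS leq_eqVlt; split.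
      by case/predU1P=> [->|/Ds[? ->]]; rewrite ?eqxx // orbT.
    by case=> Sk /predU1P[->|ltk]; rewrite ?eqxx //; apply/orP; right; apply/Ds.
  exists s => k; rewrite ltnS leq_eqVlt; split; first by case/Ds=> ? ->; rewrite orbT.
  by case=> Sk /predU1P[Dk|ltk]; [rewrite Dk in Sk | apply/Ds].
exists s => k; split=> [Sk|/Ds[] //]; apply/Ds; split=> //; exact: leB.
Qed.

Lemma value_le (S : nat -> Prop) m k : value S m -> S k -> k <= m.
Proof. by case=> _ _; apply. Qed.

(** * Words evaluated on assignments, and paths of decision trees *)

Definition sat (x : nat -> bool) (a : word) : bool := all (fun l => x l.1 == l.2) a.

Lemma matchesE T r a : matches T r a = sat (val_at T r) a.
Proof. by []. Qed.

Lemma sat_cat x a b : sat x (a ++ b) = sat x a && sat x b.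
Proof. exact: all_cat. Qed.

Lemma eq_sat_in x y a :
  (forall l, l \in a -> x l.1 = y l.1) -> sat x a = sat y a.
Proof. by move=> eqxy; apply: eq_in_all => l /eqxy ->. Qed.

Lemma sat_sub x a b : {subset a <= b} -> sat x b -> sat x a.
Proof. by move=> sab /allP xb; apply/allP => l /sab /xb. Qed.

(** The anonymous inner fixpoints of the tree functions are traded for [map] and [flatten], to which
    the general lemmas on sequences apply. *)
Definition ch_paths i (ch : seq (bool * node)) : seq (word * nat) :=
  flatten [seq [seq ((i, bc.1) :: p.1, p.2) | p <- node_paths bc.2] | bc <- ch].

Lemma node_pathsE i ch : node_paths (Node i ch) = ch_paths i ch.
Proof. by rewrite /ch_paths /=; elim: ch => //= -[b c] ch ->. Qed.

Lemma node_wfE i ch :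
  node_wf (Node i ch) = (~~ nilp ch) && all (fun bc => node_wf bc.2) ch.
Proof. by rewrite /=; congr andb; elim: ch => //= -[b c] ch ->. Qed.

Lemma node_detE i ch :
  node_det (Node i ch) = uniq (map fst ch) && all (fun bc => node_det bc.2) ch.
Proof. by rewrite /=; congr andb; elim: ch => //= -[b c] ch ->. Qed.

Lemma node_attrsE i ch :
  node_attrs (Node i ch) = i :: flatten [seq node_attrs bc.2 | bc <- ch].
Proof. by rewrite /=; congr cons; elim: ch => //= -[b c] ch ->. Qed.

(** The generated induction principle gives nothing for the children, which sit inside a list of
    pairs; here each child is reached by its position. *)
Lemma node_nested_ind (P : node -> Prop) :
  (forall d, P (Leaf d)) ->
  (forall i ch, (forall k, k < size ch -> P (nth (false, Leaf 0) ch k).2) ->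
     P (Node i ch)) ->
  forall v, P v.
Proof.
move=> PL PN; fix IH 1 => -[d|i ch]; first exact: PL.
apply: PN; elim: ch => [|[b c] ch IHch]; first by clear IH.
by case=> [_|k]; [exact: (IH c) | exact: IHch].
Qed.

Lemma ch_pathsP i ch p :
  reflect (exists2 k, k < size ch &
             let bc := nth (false, Leaf 0) ch k in
             exists2 q, q \in node_paths bc.2 & p = ((i, bc.1) :: q.1, q.2))
          (p \in node_paths (Node i ch)).
Proof.
rewrite node_pathsE; apply: (iffP flattenP) => [[s] | [k ltk [q q_in ->]]].
  case/(nthP [::])=> k; rewrite size_map => ltk <-.
  by rewrite (nth_map (false, Leaf 0)) // => /mapP[q q_in ->]; exists k => //; exists q.
exists (nth [::] [seq [seq ((i, bc.1) :: p.1, p.2) | p <- node_paths bc.2] | bc <- ch] k).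
  by rewrite mem_nth ?size_map.
by rewrite (nth_map (false, Leaf 0)) //; apply/mapP; exists q.
Qed.

Lemma path_attrs v p l : p \in node_paths v -> l \in p.1 -> l.1 \in node_attrs v.
Proof.
elim/node_nested_ind: v p => [d|i ch IH] p; first by rewrite inE => /eqP->.
rewrite node_attrsE => /ch_pathsP[k ltk [q q_in ->]] /=.
rewrite !inE => /predU1P[->|l_in]; first by rewrite eqxx.
apply/orP; right; apply/flattenP.
exists (node_attrs (nth (false, Leaf 0) ch k).2); last exact: IH q_in l_in.
by rewrite -(nth_map _ [::] (fun bc => node_attrs bc.2)) // mem_nth ?size_map.
Qed.

Lemma size_uniq_bool (s : seq bool) : uniq s -> size s <= 2.
Proof. by move=> /card_uniqP <-; rewrite -card_bool max_card. Qed.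

(** Edges leaving a node carry distinct bits, so there are at most two of them and the count at most
    doubles per level. *)
Lemma size_node_paths v h :
  node_det v -> (forall p, p \in node_paths v -> size p.1 <= h) ->
  size (node_paths v) <= 2 ^ h.
Proof.
elim/node_nested_ind: v h => [d|i ch IH] h; first by rewrite expn_gt0.
rewrite node_detE => /andP[/size_uniq_bool]; rewrite size_map => sz_ch /(all_nthP (false, Leaf 0)) det_ch le_h.
have bound k : k < size ch -> size (node_paths (nth (false, Leaf 0) ch k).2) <= 2 ^ h.-1.
  move=> ltk; apply: IH => // [|q q_in]; first exact: det_ch.
  have /le_h /= : ((i, (nth (false, Leaf 0) ch k).1) :: q.1, q.2) \in node_paths (Node i ch).
    by apply/ch_pathsP; exists k => //; exists q.
  by case: h {le_h}.
rewrite node_pathsE /ch_paths size_flatten /shape -map_comp sumnE big_map.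
(* For [h = 0] the predecessor [h.-1] is 0 as well and [bound] is too weak; but then no child has a
   path, since it would extend to one of positive length. *)
have [h0|h_gt0] := posnP h.
  rewrite (big_nth (false, Leaf 0)) big1_seq // => k /andP[_].
  rewrite mem_index_iota /= size_map => ltk.
  apply/eqP; rewrite size_eq0; apply/eqP.
  case Dp: (node_paths _) => [|q qs] //.
  have : ((i, (nth (false, Leaf 0) ch k).1) :: q.1, q.2) \in node_paths (Node i ch).
    by apply/ch_pathsP; exists k => //; exists q; rewrite // Dp mem_head.
  by move/le_h; rewrite h0.
rewrite (big_nth (false, Leaf 0)).
apply: (@leq_trans (\sum_(0 <= k < size ch) 2 ^ h.-1)); last first.
  by rewrite sum_nat_const_nat subn0 -[in leqRHS](prednK h_gt0) expnS leq_mul2r sz_ch orbT.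
rewrite !big_seq; apply: leq_sum => k.
by rewrite mem_index_iota /= size_map => /bound.
Qed.

(** * Restriction of a table to a set of attributes *)

Section Restriction.
Variables (T : table) (C : seq nat) (nu : seq bool -> seq nat).

(** A closed class contains this table as soon as [nu] takes legal decision sets as values. [opI]
    names the deleted columns, hence the complement of [C]. *)
Definition restr : table := opJ nu (opI [seq i <- cols T | i \notin C] T).

Lemma cols_opI D : cols (opI D T) = [seq i <- cols T | i \notin D].
Proof. by rewrite /opI; case: eqP. Qed.

Lemma cols_restr : cols restr = [seq i <- cols T | i \in C].
Proof.
rewrite /= cols_opI; apply: eq_in_filter => i iT.
by rewrite mem_filter iT andbT negbK.
Qed.

Lemma mem_keep_first seen s y :
  (y \in map fst (keep_first seen s)) = (y \in map fst s) && (y \notin seen).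
Proof.
elim: s seen => //= x s IH seen; case: ifP => x_seen.
  by rewrite IH inE; case: eqP => // ->; rewrite x_seen !andbF.
rewrite inE IH !inE negb_or; case: eqP => //= ->.
by rewrite x_seen.
Qed.

Definition restr_vec (r : seq bool) := [seq val_at T r i | i <- [seq i <- cols T | i \in C]].

(** [C] must meet the columns, since [opI] otherwise returns [Lambda]. Discarding coinciding rows
    loses nothing, because [nu] relabels by the values alone. *)
Lemma mem_restr_rows x : has (mem C) (cols T) ->
  (x \in rows restr) = (x.1 \in [seq restr_vec r.1 | r <- rows T]) && (x.2 == nu x.1).
Proof.
move=> hasC; have := cols_restr; rewrite /restr /= /opI.
case: eqP => [k0 | _] /= Dk; first by move: hasC; rewrite has_filter -Dk.
set K := keep_first _ _.
have memK y : (y \in map fst K) = (y \in [seq restr_vec r.1 | r <- rows T]).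
  rewrite mem_keep_first andbT -map_comp; congr (_ \in _).
  by apply: eq_map => r /=; rewrite Dk.
apply/mapP/andP => [[y yK ->] | [xK /eqP xnu]] /=.
  by rewrite -memK map_f.
move: xK; rewrite -memK => /mapP[y yK Dy]; exists y => //=.
by case: x xnu Dy => a b /= -> ->.
Qed.

Lemma val_at_restr r i : i \in cols T -> i \in C ->
  val_at restr (restr_vec r) i = val_at T r i.
Proof.
move=> iT iC; have iK: i \in [seq i <- cols T | i \in C] by rewrite mem_filter iC.
by rewrite {1}/val_at cols_restr (nth_map 0) ?index_mem // nth_index.
Qed.

Lemma sat_restr r a : (forall l, l \in a -> (l.1 \in cols T) && (l.1 \in C)) ->
  sat (val_at restr (restr_vec r)) a = sat (val_at T r) a.
Proof.
by move=> aC; apply: eq_sat_in => l /aC/andP[lT lC]; rewrite val_at_restr.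
Qed.

Lemma restr_in_closure : (forall s, dec_canon (nu s)) -> in_closure T restr.
Proof.
move=> nu_ok; exists [seq i <- cols T | i \notin C], nu; split=> // i.
by rewrite mem_filter => /andP[].
Qed.

End Restriction.

(** * Building decision trees, and fooling them *)

Section GoodTrees.
Variables (C : seq nat) (ok : word -> nat -> Prop).

(** [b] holds the answers given before [v] is reached, [d] bounds the queries still to come, and
    [ok] judges a complete word of answers with its decision. Every assignment must reach a leaf,
    even one that comes from no row. *)
Definition good (b : word) (d : nat) (v : node) : Prop :=
  [/\ node_wf v, node_det v, {subset node_attrs v <= C},
      forall x, exists2 p, p \in node_paths v & sat x p.1
    & forall p, p \in node_paths v -> size p.1 <= d /\ ok (b ++ p.1) p.2].

Lemma good_leaf b d x : ok b x -> good b d (Leaf x).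
Proof.
move=> okx; split=> //; first by move=> y; exists ([::], x); rewrite ?mem_head.
by move=> p; rewrite inE => /eqP-> /=; rewrite cats0.
Qed.

Lemma good_node b d i v0 v1 : i \in C ->
  good (rcons b (i, false)) d v0 -> good (rcons b (i, true)) d v1 ->
  good b d.+1 (Node i [:: (false, v0); (true, v1)]).
Proof.
move=> iC [wf0 det0 at0 tot0 ok0] [wf1 det1 at1 tot1 ok1].
split; first by rewrite node_wfE /= wf0 wf1.
- by rewrite node_detE /= det0 det1.
- move=> j; rewrite node_attrsE /= cats0 inE mem_cat.
  by case/or3P => [/eqP->|/at0|/at1].
- move=> x; case Dx: (x i).
    have [p p_in xp] := tot1 x; exists ((i, true) :: p.1, p.2); last by rewrite /= Dx.
    by apply/ch_pathsP; exists 1 => //; exists p.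
  have [p p_in xp] := tot0 x; exists ((i, false) :: p.1, p.2); last by rewrite /= Dx.
  by apply/ch_pathsP; exists 0 => //; exists p.
move=> p /ch_pathsP[[|[|//]] _ /= [q q_in ->]] /=.
  by have [le_d] := ok0 q q_in; rewrite cat_rcons.
by have [le_d] := ok1 q q_in; rewrite cat_rcons.
Qed.

(** A round of fixed queries is the complete binary tree over [q]; each vector [s] of answers
    continues with its own tree. *)
Lemma good_query b d q : {subset q <= C} ->
  (forall s, size s = size q -> exists v, good (b ++ zip q s) d v) ->
  exists v, good b (size q + d) v.
Proof.
elim: q b => [|i q IHq] b qC ex_v.
  by have [v] := ex_v [::] erefl; rewrite cats0; exists v.
have branch e : exists v, good (rcons b (i, e)) (size q + d) v.
  apply: IHq => [j jq|s sz_s]; first by apply: qC; rewrite inE jq orbT.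
  by have [|v] := ex_v (e :: s); rewrite /= ?sz_s // cat_rcons; exists v.
have [[v0 g0] [v1 g1]] := (branch false, branch true).
by exists (Node i [:: (false, v0); (true, v1)]); apply: good_node; rewrite // qC ?mem_head.
Qed.

End GoodTrees.

(* An adversary answering the queries of a deterministic tree, keeping [Inv]
   true of the answers given so far, drives the computation to a leaf. *)
Lemma adversary (live : (nat -> bool) -> Prop) (Inv : word -> Prop) (C : seq nat) D v b :
  (forall b i, Inv b -> size b < D -> i \in C -> exists e, Inv (rcons b (i, e))) ->
  (forall b, Inv b -> exists2 x, live x & sat x b) ->
  node_det v -> {subset node_attrs v <= C} ->
  (forall x, live x -> sat x b -> exists2 p, p \in node_paths v & sat x p.1) ->
  (forall p, p \in node_paths v -> size b + size p.1 <= D) ->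
  Inv b -> exists2 p, p \in node_paths v & Inv (b ++ p.1).
Proof.
move=> step alive; elim/node_nested_ind: v b => [d|i ch IH] b.
  by move=> _ _ _ _ Ib; exists ([::], d); rewrite ?mem_head ?cats0.
rewrite node_detE => /andP[uch /(all_nthP (false, Leaf 0)) det_ch] sC cov le_D Ib.
have [x0 lx0 x0b] := alive b Ib.
have [p0 p0_in _] := cov x0 lx0 x0b.
have ltbD: size b < D.
  have := le_D p0 p0_in; case/ch_pathsP: p0_in => k _ [q _ ->] /=.
  by rewrite addnS; apply: leq_trans; rewrite ltnS leq_addr.
have iC: i \in C by apply: sC; rewrite node_attrsE mem_head.
have [e Ibe] := step b i Ib ltbD iC.
have [x lx xbe] := alive _ Ibe.
have child y : live y -> sat y (rcons b (i, e)) -> exists2 k, k < size ch &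
    let bc := nth (false, Leaf 0) ch k in
    bc.1 = e /\ exists2 q, q \in node_paths bc.2 & sat y q.1.
  move=> ly; rewrite -cats1 sat_cat /= andbT => /andP[yb /eqP yi].
  have [p /ch_pathsP[k ltk [q q_in ->]] /= /andP[/eqP yk yq]] := cov y ly yb.
  by exists k => //; split; [rewrite -yk yi | exists q].
have [k ltk /= [De _]] := child x lx xbe.
have [|j j_in||p p_in||q q_in Iq] := IH k ltk (rcons b (i, e)) => //.
- exact: det_ch.
- apply: sC; rewrite node_attrsE inE; apply/orP; right; apply/flattenP.
  exists (node_attrs (nth (false, Leaf 0) ch k).2) => //.
  by rewrite -(nth_map _ [::] (fun bc => node_attrs bc.2)) // mem_nth ?size_map.
(* Distinct edge labels make every live assignment that answers [e] enter the same child. *)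
- move=> y ly ybe; have [k' ltk' /= [De' ex_q]] := child y ly ybe.
  suff Dk: k' = k by rewrite -Dk.
  apply/eqP; rewrite -(nth_uniq false _ _ uch) ?size_map //.
  by rewrite !(nth_map (false, Leaf 0)) // De De'.
- rewrite size_rcons addSnnS; apply: (le_D ((i, e) :: p.1, p.2)).
  by apply/ch_pathsP; exists k => //; exists p; rewrite // De.
exists ((i, e) :: q.1, q.2); last by rewrite /= -cat_rcons.
by apply/ch_pathsP; exists k => //; exists q; rewrite // De.
Qed.

Lemma uniq_notin_ex (X : eqType) (a b : seq X) :
  uniq a -> size b < size a -> exists2 l, l \in a & l \notin b.
Proof.
move=> ua ltba; case: (altP (@allP _ (mem b) a)) => [sab | /allPn //].
by have := uniq_leq_size ua sab; rewrite leqNgt ltba.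
Qed.

(** * Complexity measures and trees of least complexity *)

Section Measure.
Variable psi : measure_type.
Hypothesis psi_bounded : bounded_measure psi.

Lemma size_psi_w a : size a <= psi_w psi a.
Proof. by have [_ /(_ (map fst a))] := psi_bounded; rewrite size_map. Qed.

Lemma psi_letter a l : l \in a -> psi [:: l.1] <= psi_w psi a.
Proof.
have [[_ psi_perm psi_cat _] _] := psi_bounded.
by move/(map_f fst)/perm_to_rem/psi_perm; rewrite /psi_w => ->; apply: psi_cat [:: _] _.
Qed.

Lemma psi_w_le a n : (forall l, l \in a -> psi [:: l.1] <= n) -> psi_w psi a <= n * size a.
Proof.
have [[psi0 _ _ psi_cat] _] := psi_bounded.
elim: a => [_|l a IHa le_n]; first by have := psi0 [::]; rewrite eqxx => /eqP; rewrite /psi_w /= => ->.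
rewrite /psi_w /= mulnS -cat1s; apply: leq_trans (psi_cat _ _) _.
by rewrite leq_add ?le_n ?mem_head // IHa // => j ja; rewrite le_n // inE ja orbT.
Qed.

Lemma psi_tree_leP G n :
  reflect (forall p, p \in tree_paths G -> psi_w psi p.1 <= n) (psi_tree psi G <= n).
Proof.
apply: (iffP idP) => [le_n p p_in | le_n]; last by apply/bigmax_leqP_seq => p /le_n.
apply: leq_trans le_n; rewrite /psi_tree.
exact: (leq_bigmax_seq (P := xpredT) (F := fun p => psi_w psi p.1) p).
Qed.

Lemma psi_a_ex T G : ~~ is_empty_table T -> nondet_tree_for T G ->
  exists2 k, psi_a_is psi T k & k <= psi_tree psi G.
Proof.
move=> T_n0 treeG.
have [|k [G' treeG' <-] mink] :=
  @ex_least (fun k => exists2 G, nondet_tree_for T G & psi_tree psi G = k).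
  by exists (psi_tree psi G), G.
exists (psi_tree psi G'); last by apply: mink; exists G.
rewrite /psi_a_is (negPf T_n0); split; first by exists G'.
by move=> G2 treeG2; apply: mink; exists G2.
Qed.

Lemma psi_d_ex T G : ~~ is_empty_table T -> det_tree_for T G ->
  exists2 k, psi_d_is psi T k & k <= psi_tree psi G.
Proof.
move=> T_n0 treeG.
have [|k [G' treeG' <-] mink] :=
  @ex_least (fun k => exists2 G, det_tree_for T G & psi_tree psi G = k).
  by exists (psi_tree psi G), G.
exists (psi_tree psi G'); last by apply: mink; exists G.
rewrite /psi_d_is (negPf T_n0); split; first by exists G'.
by move=> G2 treeG2; apply: mink; exists G2.
Qed.

End Measure.

Lemma tree_paths1 v : tree_paths [:: v] = node_paths v.
Proof. by rewrite /tree_paths /= cats0. Qed.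

Lemma good_det_tree T C d v : {subset C <= cols T} ->
  good C (fun b e => forall r, r \in rows T -> sat (val_at T r.1) b -> e \in r.2) [::] d v ->
  det_tree_for T [:: v].
Proof.
move=> CT [wfv detv atv totv okv]; split; last by rewrite /tree_det /= detv.
split; rewrite ?tree_paths1 /tree_wf /= ?wfv //.
- by move=> i; rewrite /tree_attrs /= cats0 => /atv/CT.
- by move=> r _; apply: totv.
- move=> p p_in r; rewrite mem_filter => /andP[rp rT].
  by have [_ okp] := okv p p_in; apply: okp.
Qed.

Lemma uniq_map_inj (X Y : eqType) (f : X -> Y) s : uniq (map f s) -> {in s &, injective f}.
Proof.
elim: s => //= x s IHs /andP[xNs us] y z; rewrite !inE.
case/predU1P=> [->|ys] /predU1P[->|zs] // eqf; last exact: IHs.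
  by rewrite eqf map_f in xNs.
by rewrite -eqf map_f in xNs.
Qed.

(** Querying every column isolates at most one row. *)
Lemma full_det_tree T : wf_table T -> exists G, det_tree_for T G.
Proof.
case/and5P=> uc /allP sz ur /allP dec _.
pose ok b e := forall r, r \in rows T -> sat (val_at T r.1) b -> e \in r.2.
have [|s sz_s|v gv] := @good_query (cols T) ok [::] 0 (cols T); first by [].
  have [d dP] : exists d, ok (zip (cols T) s) d; last first.
    by exists (Leaf d); apply: good_leaf.
  have row_eq r : r \in rows T -> sat (val_at T r.1) (zip (cols T) s) -> r.1 = s.
    move=> rT /allP rs; have /eqP szr := sz r rT.
    apply: (@eq_from_nth _ false) => [|k]; rewrite szr ?sz_s // => ltk.
    have /rs : (nth 0 (cols T) k, nth false s k) \in zip (cols T) s.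
      by rewrite -nth_zip ?sz_s // mem_nth // size_zip sz_s minnn.
    by rewrite /val_at /= index_uniq // => /eqP.
  case: (altP (@hasP _ (fun r => r.1 == s) (rows T))) => [[r rT /eqP Ds]|/hasPn noP].
    exists (head 0 r.2) => r' r'T r's; have Dr := row_eq r' r'T r's.
    have <-: r = r' by apply: (uniq_map_inj ur); rewrite // Ds Dr.
    have := dec r rT; rewrite /dec_canon; case: (r.2) => [|d ds]; first by rewrite andbF.
    by rewrite mem_head.
  (* These answers belong to no row, so any decision is correct. *)
  exists 0 => r rT /row_eq Dr; by have := noP r rT; rewrite Dr ?eqxx.
by exists [:: v]; apply: good_det_tree gv.
Qed.

(** A forest of such single-path trees is a nondeterministic tree with prescribed path words. *)
Definition chain (a : word) (d : nat) : node :=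
  foldr (fun l v => Node l.1 [:: (l.2, v)]) (Leaf d) a.

Lemma chain_paths a d : node_paths (chain a d) = [:: (a, d)].
Proof. by elim: a => //= -[i b] a ->. Qed.

Lemma chain_wf a d : node_wf (chain a d).
Proof. by elim: a => //= l a ->. Qed.

Lemma chain_attrs a d : node_attrs (chain a d) = map fst a.
Proof. by elim: a => //= l a ->; rewrite cats0. Qed.

(** * From covers to search problems *)

Section SearchTree.
Variables (A : table -> Prop) (psi : measure_type) (n h : nat).
Hypothesis A_closed : closed_class A.
Hypothesis H_le : forall k, H_set psi A n k -> k <= h.

Lemma closed_wf T : A T -> wf_table T.
Proof. by case: A_closed => /(_ T). Qed.

Lemma closed_in_closure T Q : A T -> in_closure T Q -> A Q.
Proof. by case: A_closed => _ [_ clA] AT TQ; apply/clA; exists T. Qed.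

Lemma Lambda_in : A Lambda.
Proof.
case: A_closed => _ [[T AT] _]; apply: (closed_in_closure AT).
exists (cols T), (fun=> [:: 0]); split=> //; split=> //; rewrite /opI.
by rewrite (eq_in_filter (a2 := pred0)) ?filter_pred0 // => i /= ->.
Qed.

(** The vector [s] is read as an assignment to the columns [K]. The default [[:: 0]] keeps the
    decision set nonempty on vectors that satisfy no member of [U]. *)
Definition hits (K : seq nat) (U : seq word) (s : seq bool) : seq nat :=
  let ks := [seq k <- iota 0 (size U) |
               sat (fun i => nth false s (index i K)) (nth [::] U k)] in
  if ks == [::] then [:: 0] else ks.

Lemma hits_canon K U s : dec_canon (hits K U s).
Proof.
rewrite /hits /dec_canon; case: ifP => // /negbT ->; rewrite andbT.
by apply: (sorted_filter ltn_trans); apply: iota_ltn_sorted.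
Qed.

(* Labelling the rows of a table by the members of a cover that they satisfy
   turns any cover into a problem of nondeterministic complexity at most [n]. *)
Lemma search_tree T (C : seq nat) (U : seq word) :
  A T -> ~~ is_empty_table T -> has (mem C) (cols T) -> {subset C <= cols T} ->
  (forall a, a \in U -> psi_w psi a <= n) ->
  (forall a l, a \in U -> l \in a -> l.1 \in C) ->
  (forall r, r \in rows T -> exists2 a, a \in U & matches T r.1 a) ->
  exists v, [/\ node_det v, {subset node_attrs v <= C},
    forall p, p \in node_paths v -> psi_w psi p.1 <= h,
    forall r, r \in rows T -> exists2 p, p \in node_paths v & matches T r.1 p.1
  & forall p r, p \in node_paths v -> r \in rows T -> matches T r.1 p.1 ->
      p.2 < size U /\ matches T r.1 (nth [::] U p.2)].
Proof.
move=> AT T_n0 hasC CT U_le UC U_cov.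
set K := [seq i <- cols T | i \in C].
set nu := hits K U.
have AT' : A (restr T C nu).
  exact: closed_in_closure AT (restr_in_closure _ _ (hits_canon K U)).
set T' := restr T C nu in AT'.
have cT' : cols T' = K := cols_restr T C nu.
have memK i : (i \in K) = (i \in C).
  by rewrite mem_filter; case iC: (i \in C); rewrite // CT.
have row_in r : r \in rows T -> (restr_vec T C r.1, nu (restr_vec T C r.1)) \in rows T'.
  by move=> rT; rewrite mem_restr_rows // eqxx andbT (map_f (fun r => restr_vec T C r.1)).
have satE r a : (forall l, l \in a -> l.1 \in C) ->
    sat (val_at T' (restr_vec T C r)) a = sat (val_at T r) a.
  by move=> aC; apply: sat_restr => l /aC lC; rewrite CT.
have nuE r : r \in rows T -> forall k,
    k \in nu (restr_vec T C r.1) -> k < size U /\ matches T r.1 (nth [::] U k).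
  move=> rT k.
  have satU j : j < size U -> sat (fun i => nth false (restr_vec T C r.1) (index i K)) (nth [::] U j)
       = sat (val_at T r.1) (nth [::] U j).
    move=> ltj; rewrite -(satE r.1) => [|l l_in]; last by apply: UC l_in; apply: mem_nth.
    by apply: eq_sat_in => l _; rewrite /val_at cT'.
  (* Falling back to the default would mean that no word of [U] matches the row, against [U_cov]. *)
  rewrite /nu /hits; case: eqP => [ks0 | _].
    have [a aU ra] := U_cov r rT.
    have: index a U \in @nil nat by rewrite -ks0 mem_filter mem_iota add0n index_mem aU !andbT satU ?index_mem // nth_index.
    by [].
  by rewrite mem_filter mem_iota add0n /= andbC => /andP[ltk]; rewrite satU.
have T'_n0: ~~ is_empty_table T'.
  move: T_n0; rewrite /is_empty_table; case Dr: (rows T) => [|r rs] // _.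
  by apply: contraTneq (row_in r _) => [->|]; rewrite // Dr mem_head.
have Tr' r' : r' \in rows T' -> exists2 r, r \in rows T & r' = (restr_vec T C r.1, nu (restr_vec T C r.1)).
  rewrite mem_restr_rows // => /andP[/mapP[r rT Dr] /eqP Dr2]; exists r => //.
  by case: r' Dr Dr2 => s d /= -> ->.
(* One chain per word of [U], with its index as decision, solves the relabelled table
   nondeterministically at cost at most [n]. *)
pose G := [seq chain (nth [::] U k) k | k <- iota 0 (size U)].
have pathsG : tree_paths G = [seq (nth [::] U k, k) | k <- iota 0 (size U)].
  rewrite /tree_paths -map_comp (eq_map (g := fun k => [:: (nth [::] U k, k)])).
    by elim: (iota _ _) => //= k s ->.
  by move=> k /=; rewrite chain_paths.
have treeG : nondet_tree_for T' G.
  split.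
  - apply/andP; split; last by rewrite all_map; apply/allP => k _; apply: chain_wf.
    rewrite /nilp size_map size_iota; move: T_n0; rewrite /is_empty_table.
    case Dr: (rows T) => [|r rs] // _; have [|a aU _] := U_cov r; first by rewrite Dr mem_head.
    by case: (U) aU.
  - move=> i; rewrite /tree_attrs -map_comp => /flattenP[s /mapP[k]].
    rewrite mem_iota => ltk ->; rewrite /= chain_attrs cT' memK => /mapP[l l_in ->]; apply: UC l_in.
    exact: mem_nth.
  - move=> r' /Tr'[r rT ->]; have [a aU ra] := U_cov r rT.
    exists (a, index a U); last by rewrite matchesE satE // => l; apply: UC.
    by rewrite pathsG; apply/mapP; exists (index a U); rewrite ?mem_iota ?index_mem // nth_index.
  - move=> p; rewrite pathsG => /mapP[k]; rewrite mem_iota /= add0n => ltk -> r'.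
    rewrite mem_filter => /andP[/= r'k /Tr'[r rT Dr']] /=; rewrite Dr' /= /nu /hits.
    suff k_in: k \in [seq k <- iota 0 (size U) | sat (fun i => nth false (restr_vec T C r.1) (index i K)) (nth [::] U k)].
      by case: eqP => // k0; rewrite k0 in k_in.
    rewrite mem_filter mem_iota ltk !andbT; move: r'k; rewrite matchesE Dr' /=.
    by rewrite (@eq_sat_in _ (fun i => nth false (restr_vec T C r.1) (index i K))) // => l _; rewrite /val_at cT'.
have [ka psi_a le_ka] := psi_a_ex psi T'_n0 treeG.
have [G1 detG1] := full_det_tree (closed_wf AT').
have [kd psi_d _] := psi_d_ex psi T'_n0 detG1.
have le_kd : kd <= h.
  apply: H_le; exists T'; split=> //; exists ka => //; apply: leq_trans le_ka _.
  apply/psi_tree_leP => p; rewrite pathsG => /mapP[k]; rewrite mem_iota => ltk ->.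
  by apply: U_le; apply: mem_nth.
move: psi_d; rewrite /psi_d_is (negPf T'_n0) => -[[G2 [[wfG2 atG2 covG2 okG2] /andP[szG2 detG2]] DG2] _].
case: G2 szG2 wfG2 atG2 covG2 okG2 detG2 DG2 => [|v []] // _ _.
rewrite /tree_attrs tree_paths1 /= cats0 andbT => atv covv okv detv Dkd.
have atC: {subset node_attrs v <= C} by move=> i /atv; rewrite cT' memK.
have pathC p l : p \in node_paths v -> l \in p.1 -> l.1 \in C by move=> p_in /(path_attrs p_in)/atC.
exists v; split=> //.
- move=> p p_in; apply: leq_trans le_kd; rewrite -Dkd.
  by have /psi_tree_leP := leqnn (psi_tree psi [:: v]); apply; rewrite tree_paths1.
- move=> r rT; have [p p_in rp] := covv _ (row_in r rT); exists p => //.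
  by rewrite matchesE satE in rp => // l; apply: pathC.
move=> p r p_in rT rp; apply: nuE => //; apply: (okv p p_in (restr_vec T C r.1, _)).
by rewrite mem_filter row_in // andbT matchesE satE // => l; apply: pathC.
Qed.

End SearchTree.

(** * Lower bounds on deterministic complexity *)

(** Without [a] some row is left uncovered; being covered by [U], it is matched by [a] alone. *)
Lemma irreducible_cover_private psi T n U a : irreducible_cover psi T n U -> a \in U ->
  exists2 r, r \in rows T & matches T r.1 a /\ forall b, b \in U -> matches T r.1 b -> b = a.
Proof.
case=> uU [[U_ok U_cov] minU] aU.
have [r rT] : exists2 r, r \in rows T & ~~ has (matches T r.1) (rem a U).
  apply/allPn/negP => /allP all_r.
  apply: (minU (rem a U)); first exact: rem_uniq.
  - by move=> b /mem_rem.
  - by move/(_ a aU); rewrite mem_rem_uniqF.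
  by split=> [b /mem_rem/U_ok | r /all_r/hasP[b]] //; exists b.
move/hasPn=> no_b; exists r => //.
have onlya b : b \in U -> matches T r.1 b -> b = a.
  move=> bU rb; apply/eqP; apply: contraLR rb => ba; apply: no_b.
  by rewrite mem_rem_uniq // inE ba.
by split=> //; have [b bU rb] := U_cov r rT; rewrite -(onlya b).
Qed.

Lemma irreducible_ann_uniq T a : irreducible_ann T a -> uniq a.
Proof.
case=> -[aT ra consa] mina; apply: contraT => nu.
case: (mina (undup a)); rewrite ?undup_subseq ?ltn_size_undup //.
split.
- by apply/allP => l; rewrite mem_undup => /(allP aT).
- rewrite -ra; apply: eq_filter => r; rewrite !matchesE.
  by apply/idP/idP; apply: sat_sub => l; rewrite mem_undup.
by move=> i b c; rewrite !mem_undup; apply: consa.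
Qed.

(** Without [l] the word is no longer annihilating, so some row satisfies the rest; it must disagree
    at [l], as no row satisfies [a]. *)
Lemma irreducible_ann_private T a l : irreducible_ann T a -> l \in a ->
  exists2 r, r \in rows T &
    val_at T r.1 l.1 != l.2 /\ forall k, k \in a -> k != l -> val_at T r.1 k.1 == k.2.
Proof.
move=> irra la; have ua := irreducible_ann_uniq irra.
case: irra => -[aT ra consa] mina.
have rem_sat r : (forall k, k \in a -> k != l -> val_at T r k.1 == k.2) <-> sat (val_at T r) (rem l a).
  split=> [rk | /allP rl k ka kl]; last by apply: rl; rewrite mem_rem_uniq // inE kl.
  by apply/allP => k; rewrite mem_rem_uniq // inE => /andP[kl ka]; apply: rk.
have [r rT rl] : exists2 r, r \in rows T & sat (val_at T r.1) (rem l a).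
  apply/hasP; rewrite has_filter; apply/eqP => r0.
  have sz_a : 0 < size a by case: (a) la.
  apply: (mina (rem l a)); rewrite ?rem_subseq ?size_rem ?prednK //.
  split=> //; first by apply/allP => k /mem_rem /(allP aT).
  by move=> i b c /mem_rem ib /mem_rem ic; apply: consa ib ic.
exists r => //; split; last by apply/rem_sat.
apply/negP => /eqP rll; suff: r \in [::] by [].
rewrite -ra mem_filter rT andbT matchesE; apply/allP => k ka.
by have [->|kl] := eqVneq k l; [rewrite rll | move/rem_sat: rl; apply].
Qed.

(** The members of [s] are distinct tuples, as many as there are tuples at all. *)
Lemma complete_rows (s : seq (seq bool)) m : uniq s -> all (fun r => size r == m) s ->
  size s = 2 ^ m -> forall x, size x = m -> x \in s.
Proof.
move=> us /allP sz_s Ds x sz_x.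
have sz_t r : r \in s -> size r = m by move/sz_s/eqP.
pose t := pmap (insub : seq bool -> option (m.-tuple bool)) s.
have Dt : map val t = s.
  rewrite /t pmap_filter; last exact: insubK.
  by apply/all_filterP; apply/allP => r /sz_s rm; rewrite isSome_insub.
have ut : uniq t by rewrite -(map_inj_uniq val_inj) Dt.
have sz_x' : size x == m by apply/eqP.
rewrite -Dt -[x]/(val (Tuple sz_x')) (mem_map val_inj).
have /card_uniqP ct := ut.
have: #|t| = #|{: m.-tuple bool}| by rewrite ct card_tuple card_bool -Ds -Dt size_map.
by move=> eq_ct; rewrite (elimT (subset_cardP eq_ct) (subset_predT _)).
Qed.

Lemma complete_val_at Q (x : nat -> bool) : wf_table Q -> complete Q ->
  exists2 r, r \in rows Q & forall i, i \in cols Q -> val_at Q r.1 i = x i.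
Proof.
case/and5P=> uc sz ur _ _ /eqP cQ.
have /mapP[r rQ Dx] : map x (cols Q) \in map fst (rows Q).
  apply: (@complete_rows _ (size (cols Q))); rewrite ?size_map //.
  by apply/allP => y /mapP[r rQ ->]; apply: (allP sz).
by exists r => // i iQ; rewrite /val_at -Dx (nth_map 0) ?index_mem // nth_index.
Qed.

Section LowerBounds.
Variables (A : table -> Prop) (psi : measure_type).
Hypotheses (A_closed : closed_class A) (psi_bounded : bounded_measure psi).

Lemma nonempty_cols T : A T -> ~~ is_empty_table T -> cols T != [::].
Proof. by move/(closed_wf A_closed)/and5P=> [_ _ _ _ /eqP <-]. Qed.

(** The private row of each word of [U] ends in a leaf labelled with the index of that word, so
    there are at least as many leaves as words. *)
Lemma irreducible_cover_size n h T U :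
  (forall k, H_set psi A n k -> k <= h) ->
  A T -> ~~ is_empty_table T -> irreducible_cover psi T n U -> size U <= 2 ^ h.
Proof.
move=> H_le AT T_n0 irrU; have [uU [[U_ok U_cov] _]] := irrU.
have [|||||v [detv atv v_le covv corv]] := @search_tree A psi n h A_closed H_le T (cols T) U AT T_n0 => //.
- have := nonempty_cols AT T_n0; rewrite has_filter.
  by rewrite (eq_in_filter (a2 := xpredT)) ?filter_predT.
- by move=> a /U_ok[].
- by move=> a l /U_ok[/allP aT _] /aT.
have: size (map snd (node_paths v)) <= 2 ^ h.
  rewrite size_map; apply: size_node_paths => // p /v_le; apply: leq_trans.
  exact: size_psi_w.
apply: leq_trans; rewrite -(size_iota 0 (size U)); apply: uniq_leq_size; first exact: iota_uniq.
move=> k; rewrite mem_iota /= add0n => ltk.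
have [r rT [ra only_a]] := irreducible_cover_private irrU (mem_nth [::] ltk).
have [p p_in rp] := covv r rT; have [ltp rUp] := corv p r p_in rT rp.
apply/mapP; exists p => //; apply/eqP; rewrite eq_sym -(nth_uniq [::] _ _ uU) //.
by rewrite (only_a _ (mem_nth _ ltp)).
Qed.

(** With [h + 2] or more letters in [a], answering as in [a] would leave two letters unasked. Their
    private rows reach the same leaf, whose decision names the negation of one letter, but each of
    the two rows violates only its own letter. *)
Lemma irreducible_ann_size n h T a :
  (forall k, H_set psi A n k -> k <= h) ->
  A T -> ~~ is_empty_table T -> m_psi psi T <= n -> irreducible_ann T a -> size a <= h.+1.
Proof.
move=> H_le AT T_n0 /bigmax_leqP_seq m_le irra.
have ua := irreducible_ann_uniq irra; have [[/allP aT ra consa] mina] := irra.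
rewrite leqNgt; apply/negP => lt_ha.
(* Single letters cost at most [m_psi psi T], hence at most [n]. *)
pose U := [seq [:: (l.1, ~~ l.2)] | l <- a].
have aN0 : exists l, l \in a by case: (a) lt_ha => // l b; exists l; rewrite mem_head.
have [|i|b|b k|r rT|v [detv atv v_le covv corv]] := @search_tree A psi n h A_closed H_le T (map fst a) U AT T_n0 => //.
- have [l la] := aN0; apply/hasP; exists l.1; rewrite ?aT //=; exact: map_f.
- by case/mapP=> l /aT lT ->.
- by case/mapP=> l la -> /=; rewrite /psi_w /=; apply: m_le; rewrite ?aT.
- by case/mapP=> l la ->; rewrite inE => /eqP-> /=; apply: map_f.
- have: ~~ sat (val_at T r.1) a.
    apply/negP => rma; suff: r \in rows_of T a by rewrite ra.
    by rewrite mem_filter rT andbT.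
  case/allPn => l la rl; exists [:: (l.1, ~~ l.2)]; first exact: (map_f (fun l : letter => [:: (l.1, ~~ l.2)])).
  by rewrite /matches /= andbT; case: (val_at _ _ _) (l.2) rl => [] [].
have private l : l \in a -> exists2 r, r \in rows T & forall b, l \notin b -> {subset b <= a} ->
    sat (val_at T r.1) b /\ forall k, k \in a -> val_at T r.1 k.1 = ~~ k.2 -> k = l.
  case/(irreducible_ann_private irra) => r rT [rl rk]; exists r => // b lb ba.
  split; first by apply/allP => k kb; apply: rk; rewrite ?ba //; apply: contraNneq lb => <-.
  move=> k ka rkN; apply/eqP; apply: contraT => /(rk k ka); rewrite rkN; by case: (k.2).
pose live x := exists2 r, r \in rows T & x = val_at T r.1.
(* The depth is at most [h], hence at most [(size a).-2], which keeps two letters unasked. *)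
have [||_ [r rT ->] _|p p_in||p p_in [pa szp]] := @adversary live
    (fun b => {subset b <= a} /\ size b <= (size a).-2) (map fst a) (size a).-2 v [::] _ _ detv atv => //.
- move=> b i [ba _] ltb /mapP[l la ->]; exists l.2.
  rewrite size_rcons; split=> // k; rewrite mem_rcons inE -surjective_pairing.
  by case/predU1P=> [->|/ba].
- move=> b [ba szb]; have [|l la lb] := @uniq_notin_ex _ a b ua.
    by apply: leq_ltn_trans szb _; case: (size a) lt_ha => [|[|m]].
  have [r rT /(_ b lb ba)[rb _]] := private l la.
  by exists (val_at T r.1) => //; exists r.
- exact: covv.
- have := v_le p p_in; move/(leq_trans (size_psi_w psi_bounded _)) => /= szp.
  by apply: leq_trans szp _; case: (size a) lt_ha => [|[|m]].
rewrite /= in pa szp.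
have [|l la lp] := @uniq_notin_ex _ a p.1 ua.
  by apply: leq_ltn_trans szp _; case: (size a) lt_ha => [|[|m]].
have [|l' l'a] := @uniq_notin_ex _ a (l :: p.1) ua.
  by move: szp lt_ha; case: (size a) => [|[|m]] //= szp; rewrite !ltnS.
rewrite inE negb_or => /andP[/eqP ll' l'p].
have [r rT /(_ _ lp pa)[rp only_l]] := private l la.
have [r' r'T /(_ _ l'p pa)[r'p only_l']] := private l' l'a.
have [ltp] := corv p r p_in rT rp; have [_] := corv p r' p_in r'T r'p.
have /mapP[k ka ->] := mem_nth [::] ltp.
rewrite /matches /= !andbT => /eqP/(only_l' k ka) Dk /eqP/(only_l k ka) Dk'.
by apply: ll'; rewrite -Dk -Dk'.
Qed.

End LowerBounds.

(** * A pigeonhole search problem inside a complete table *)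

Section Pigeonhole.
Variables (C : seq nat) (w : nat).
Hypotheses (w_gt0 : 0 < w) (uC : uniq C) (sz_C : size C = w * w.+2).

(* The attributes of [C] are arranged in [w + 2] lines of [w] bits.  A line
   descends at [j <= w] if bit [j - 1] is 1 (or absent) and bit [j] is 0 (or absent). *)
Definition cell i j : nat := nth 0 C (i * w + j).

Definition descent i j : word :=
  (if 0 < j then [:: (cell i j.-1, true)] else [::]) ++
  (if j < w then [:: (cell i j, false)] else [::]).

(** Each word certifies that two different lines descend at the same position, by at most four
    letters. *)
Definition collisions : seq word :=
  [seq descent t.1.1 t.2 ++ descent t.1.2 t.2 |
     t : 'I_w.+2 * 'I_w.+2 * 'I_w.+1 <- enum {: 'I_w.+2 * 'I_w.+2 * 'I_w.+1}
     & t.1.1 != t.1.2 :> nat].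

Lemma collisionsP a : reflect
  (exists i k j, [/\ i < w.+2, k < w.+2, j <= w, i != k & a = descent i j ++ descent k j])
  (a \in collisions).
Proof.
apply: (iffP mapP) => [[[[i k] j]] | [i [k [j [lti ltk lej ik ->]]]]].
  rewrite mem_filter => /andP[/= ik _] ->.
  by exists i, k, j; rewrite !ltn_ord -ltnS ltn_ord.
exists ((Ordinal lti, Ordinal ltk), Ordinal (lej : j < w.+1)) => //.
by rewrite mem_filter mem_enum andbT.
Qed.

Lemma cell_lt i j : i < w.+2 -> j < w -> i * w + j < size C.
Proof. by move=> lti ltj; rewrite sz_C; nia. Qed.

Lemma cell_in i j : i < w.+2 -> j < w -> cell i j \in C.
Proof. by move=> lti ltj; apply/mem_nth/cell_lt. Qed.

Lemma descent_attrs i j l : i < w.+2 -> j <= w -> l \in descent i j -> l.1 \in C.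
Proof.
move=> lti lej; rewrite mem_cat => /orP[]; case: ifP => // lt_j; rewrite inE => /eqP-> /=;
  by apply: cell_in => //; lia.
Qed.

Lemma size_descent i j : size (descent i j) <= 2.
Proof. by rewrite size_cat; do 2!case: ifP. Qed.

(** The first 0 of the line is such a position, and [w] is one if all bits are 1. *)
Lemma ex_descent x i : exists2 j, j <= w & sat x (descent i j).
Proof.
pose s := [seq x (cell i j) | j <- iota 0 w].
have nth_s j : j < w -> nth false s j = x (cell i j).
  by move=> ltj; rewrite (nth_map 0) ?size_iota // nth_iota.
have sz_s : size s = w by rewrite size_map size_iota.
have le_j : find negb s <= w by rewrite -sz_s find_size.
exists (find negb s) => //; rewrite sat_cat; apply/andP; split; case: ifP => // lt_j.
  have ltp : (find negb s).-1 < find negb s by rewrite prednK.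
  have /negbFE := before_find false ltp; rewrite nth_s; first by rewrite /sat /= => ->.
  exact: leq_trans ltp le_j.
have /(nth_find false) : has negb s by rewrite has_find sz_s.
by rewrite nth_s // /sat /= => /negPf->.
Qed.

(** There are [w + 2] lines and only [w + 1] positions. *)
Lemma ex_collision x : exists2 a, a \in collisions & sat x a.
Proof.
have [f fP] : exists f : nat -> nat, forall i, f i <= w /\ sat x (descent i (f i)).
  pose f i := find (fun j => sat x (descent i j)) (iota 0 w.+1).
  exists f => i; have [j lej xj] := ex_descent x i.
  have hasj : has (fun j => sat x (descent i j)) (iota 0 w.+1).
    by apply/hasP; exists j; rewrite // mem_iota.
  have := hasj; rewrite has_find size_iota => ltf; split=> //.
  by have := nth_find 0 hasj; rewrite nth_iota // add0n.
have /(uniqPn 0)[i [k []]] : ~~ uniq [seq f i | i <- iota 0 w.+2].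
  apply/negP => uf; have := @uniq_leq_size _ _ (iota 0 w.+1) uf.
  rewrite size_map !size_iota ltnn => absurd; suff: false by []; apply: absurd.
  by move=> _ /mapP[i _ ->]; rewrite mem_iota ltnS; case: (fP i).
rewrite size_map size_iota => ltik ltk.
have lti := ltn_trans ltik ltk.
rewrite !(nth_map 0) ?size_iota // !nth_iota // !add0n => Dfi.
have [[lefi xi] [_ xk]] := (fP i, fP k).
exists (descent i (f i) ++ descent k (f i)); last by rewrite sat_cat xi Dfi.
by apply/collisionsP; exists i, k, (f i); split; rewrite // neq_ltn ltik.
Qed.

(** Thermometer code: line [i] consists of [f i] ones followed by zeros, so for [f i <= w] its only
    descent is at [f i]. *)
Definition thermo (f : nat -> nat) (c : nat) : bool := index c C %% w < f (index c C %/ w).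

Lemma thermo_cell f i j : i < w.+2 -> j < w -> thermo f (cell i j) = (j < f i).
Proof.
move=> lti ltj; rewrite /thermo /cell index_uniq ?cell_lt //.
by rewrite modnMDl modn_small // divnMDl // divn_small // addn0.
Qed.

Lemma thermo_descent f i j : i < w.+2 -> j <= w -> f i <= w ->
  sat (thermo f) (descent i j) -> f i = j.
Proof.
move=> lti lej le_fi; rewrite sat_cat => /andP[].
case: ifP => j0; case: ifP => jw; rewrite /sat /= ?thermo_cell ?andbT //; lia.
Qed.

(** At most [w] of the [w + 1] possible values are taken on [S], which leaves a fresh one for
    [r]. *)
Lemma extend_inj (f : nat -> nat) (S : seq nat) r : size S <= w ->
  (forall i, f i <= w) -> {in S &, injective f} ->
  exists g, [/\ forall i, g i <= w, {in S, g =1 f} & {in r :: S &, injective g}].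
Proof.
move=> szS lef injf; have [rS|rS] := boolP (r \in S).
  by exists f; split=> // i j; rewrite !inE => /predU1P[->|iS] /predU1P[->|jS]; apply: injf.
have [||u] := @uniq_notin_ex _ (iota 0 w.+1) (map f S); rewrite ?iota_uniq ?size_map ?size_iota //.
rewrite mem_iota ltnS => /= leu uS.
exists (fun i => if i == r then u else f i); split=> [i | i iS | i j].
- by case: ifP.
- by case: eqP => // ir; rewrite -ir iS in rS.
rewrite !inE; case: eqP => [-> _ | _ /= iS]; case: eqP => [-> // | _ /= jS].
- by move=> Du; rewrite Du map_f in uS.
- by move=> _ Du; rewrite -Du map_f in uS.
exact: injf.
Qed.

Definition lines (b : word) : seq nat := [seq index l.1 C %/ w | l <- b].

Lemma sat_thermo_eq f g b : {in lines b, g =1 f} -> sat (thermo g) b = sat (thermo f) b.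
Proof. by move=> eqfg; apply: eq_sat_in => l lb; rewrite /thermo eqfg // (map_f (fun l => index l.1 C %/ w)). Qed.

(** The invariant of the adversary: the answers come from thermometer codes that differ on the lines
    asked about. The bound [size b < w] leaves room for two further lines. *)
Definition matching (b : word) : Prop := (forall l, l \in b -> l.1 \in C) /\ size b < w /\
  exists f, [/\ forall i, f i <= w, sat (thermo f) b & {in lines b &, injective f}].

Lemma matching_step b c : matching b -> size b < w.-1 -> c \in C ->
  exists e, matching (rcons b (c, e)).
Proof.
move=> [bC [szb [f [lef satf injf]]]] ltb cC.
have [|g [leg eqg injg]] := @extend_inj f (lines b) (index c C %/ w) _ lef injf.
  by rewrite size_map ltnW.
exists (thermo g c); split; last split.
- by move=> l; rewrite mem_rcons inE => /predU1P[->|/bC].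
- by rewrite size_rcons; case: (w) ltb.
exists g; split=> //; first by rewrite -cats1 sat_cat (sat_thermo_eq eqg) satf /sat /= eqxx.
by rewrite /lines map_rcons => i j; rewrite !mem_rcons; apply: injg.
Qed.

(** Extending [f] injectively to both lines named by [a] puts their only descents at different
    positions. *)
Lemma matching_no_collision b a : matching b -> a \in collisions ->
  exists2 f, sat (thermo f) b & ~~ sat (thermo f) a.
Proof.
move=> [bC [szb [f [lef satf injf]]]] /collisionsP[i [k [j [lti ltk lej ik ->]]]].
have [|g [leg eqg injg]] := @extend_inj f (lines b) i _ lef injf; first by rewrite size_map ltnW.
(* This extension starts from [size b + 1] entries, hence the strict inequality in [matching]. *)
have [|g' [leg' eqg' injg']] := @extend_inj g (i :: lines b) k _ leg injg; first by rewrite /= size_map.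
exists g'.
  rewrite (@sat_thermo_eq f) // => r rb; rewrite eqg' ?eqg //.
  by rewrite inE rb orbT.
rewrite sat_cat; apply/negP => /andP[/(thermo_descent lti lej (leg' i)) Di].
move/(thermo_descent ltk lej (leg' k)) => Dk; case/eqP: ik.
by apply: injg'; rewrite ?Di ?Dk // !inE eqxx ?orbT.
Qed.

End Pigeonhole.

(** A tree that finds collisions is led to a leaf, and the certificate named there is refuted by
    another row following the same path. The factor 4 pays for certificates of four letters. *)
Lemma complete_table_size A psi n h Q : closed_class A -> bounded_measure psi ->
  (forall k, H_set psi A (n * 4) k -> k <= h) ->
  A Q -> ~~ is_empty_table Q -> m_psi psi Q <= n -> complete Q ->
  size (cols Q) < h.+1 * h.+3.
Proof.
move=> A_closed psi_bounded H_le AQ Q_n0 /bigmax_leqP_seq m_le cQ.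
rewrite ltnNge; apply/negP => le_hQ.
have wfQ := closed_wf A_closed AQ; have uQ : uniq (cols Q) by case/and5P: wfQ.
(* The adversary survives [w.-1] queries, which is exactly the depth bound [h]. *)
pose w := h.+1; pose C := take (w * w.+2) (cols Q).
have sz_C : size C = w * w.+2 by rewrite size_take_min; apply/minn_idPl.
have uC : uniq C by apply: take_uniq.
have CQ : {subset C <= cols Q} by apply: mem_take.
have w_gt0 : 0 < w by [].
have coll_attrs a l : a \in collisions C w -> l \in a -> l.1 \in C.
  case/collisionsP=> i [k [j [lti ltk lej _ ->]]]; rewrite mem_cat.
  by case/orP; apply: descent_attrs.
have real x : exists2 r, r \in rows Q & forall b, (forall l, l \in b -> l.1 \in C) ->
    sat (val_at Q r.1) b = sat x b.
  have [r rQ rx] := complete_val_at x wfQ cQ; exists r => // b bC.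
  by apply: eq_sat_in => l /bC/CQ/rx.
have [|a aU|r rQ|v [detv atv v_le covv corv]] :=
    @search_tree A psi (n * 4) h A_closed H_le Q C (collisions C w) AQ Q_n0 _ CQ _ coll_attrs => //.
- have: 0 < size C by rewrite sz_C.
  case: C CQ {sz_C uC coll_attrs real} => // c C' CQ _.
  by apply/hasP; exists c; rewrite /= ?CQ ?mem_head.
- apply: leq_trans (psi_w_le psi_bounded (n := n) _) _.
    by move=> l /(coll_attrs a l aU)/CQ/m_le; apply.
  rewrite leq_mul2l; apply/orP; right.
  by case/collisionsP: aU => i [k [j [_ _ _ _ ->]]]; rewrite size_cat (@leq_add _ _ 2 2) ?size_descent.
- exact: ex_collision.
pose live x := exists2 r, r \in rows Q & x = val_at Q r.1.
have [||_ [r rQ ->] _|p p_in||p p_in pM] :=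
    @adversary live (matching C w) C w.-1 v [::] _ _ detv atv => //.
- exact: matching_step.
- move=> b [bC [_ [f [_ satf _]]]]; have [r rQ rx] := real (thermo C w f).
  by exists (val_at Q r.1); [exists r | rewrite rx].
- exact: covv.
- exact: leq_trans (size_psi_w psi_bounded _) (v_le p p_in).
- by split=> //; split=> //; exists (fun=> 0); split.
have pC l : l \in p.1 -> l.1 \in C by case: pM => /(_ l).
have U_in r : r \in rows Q -> sat (val_at Q r.1) p.1 ->
    nth [::] (collisions C w) p.2 \in collisions C w /\
    sat (val_at Q r.1) (nth [::] (collisions C w) p.2).
  by move=> rQ rp; have [ltp] := corv p r p_in rQ rp; split; first exact: mem_nth.
(* Some row must reach the leaf before its decision is known to be an index of a certificate. *)
have [f0 satf0]: exists f, sat (thermo C w f) p.1 by case: pM => _ [_ [f []]]; exists f.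
have [r0 r0Q r0x] := real (thermo C w f0).
have [collp _] := U_in r0 r0Q (etrans (r0x _ pC) satf0).
have [f satf /negP] := matching_no_collision w_gt0 uC sz_C pM collp; apply.
have [r rQ rx] := real (thermo C w f).
have [_] := U_in r rQ (etrans (rx _ pC) satf).
by rewrite rx // => l; apply: coll_attrs.
Qed.

(** * Upper bound on deterministic complexity *)

(** Shattering in the sense of Vapnik and Chervonenkis, with [K] a set of coordinates. *)
Definition shatters (F : seq (seq bool)) (K : seq nat) : Prop :=
  forall x : nat -> bool, exists2 r, r \in F & forall i, i \in K -> nth false r i = x i.

(** Induction on [m]: deleting the first coordinate leaves the projections [P], and [B] collects
    those with both extensions. A set shattered by [B] can be enlarged by coordinate 0 in [F], so
    [B] satisfies the hypothesis with [z - 1]. *)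
Lemma sauer_shelah m z (F : seq (seq bool)) :
  uniq F -> (forall r, r \in F -> size r = m) ->
  (forall K, uniq K -> {subset K <= iota 0 m} -> shatters F K -> size K <= z) ->
  size F <= m.+1 ^ z.
Proof.
elim: m z F => [|m IHm] z F uF szF shF.
  rewrite exp1n; apply: (@uniq_leq_size _ _ [:: [::]]) => // r /szF /size0nil ->.
  exact: mem_head.
pose P := undup (map behead F).
pose a t := true :: t \in F.
pose B := [seq t <- P | (true :: t \in F) && (false :: t \in F)].
have FE r : r \in F -> r = head false r :: behead r by move/szF; case: r.
have leF : size F <= size P + size B.
  (* [a t] is the first bit of one extension of [t] in [F]; a second extension is charged to [B]. *)
  have <-: size ([seq a t :: t | t <- P] ++ [seq ~~ a t :: t | t <- B]) = size P + size B.
    by rewrite size_cat !size_map.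
  apply: uniq_leq_size => // r rF; have tP : behead r \in P by rewrite mem_undup map_f.
  have Dr := FE r rF; rewrite mem_cat; case Da: (a (behead r) == head false r).
    by apply/orP; left; apply/mapP; exists (behead r); rewrite ?(eqP Da).
  have tB : behead r \in B.
    rewrite mem_filter tP andbT; move: Da; rewrite /a.
    case: (head false r) Dr => Dr; rewrite -Dr rF ?andbT //=.
    by case: (_ \in F).
  apply/orP; right; apply/mapP; exists (behead r) => //.
  by rewrite {1}Dr; congr (_ :: _); move: Da; case: (a _); case: (head _ _).
have szP t : t \in P -> size t = m.
  by rewrite mem_undup => /mapP[r /szF szr ->]; rewrite size_behead szr.
have shP K : shatters P K -> shatters F (map S K).
  move=> shK x; have [t] := shK (x \o S); rewrite mem_undup => /mapP[r rF ->] tx.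
  by exists r => // _ /mapP[i iK ->]; rewrite (FE r rF) /=; apply: tx.
have shB K : shatters B K -> shatters F (0 :: map S K).
  move=> shK x; have [t] := shK (x \o S).
  rewrite mem_filter => /andP[/andP[tF1 tF0] _] tx; exists (x 0 :: t).
    by case: (x 0).
  by move=> i; rewrite inE => /predU1P[->|/mapP[j jK ->]] //=; apply: tx.
have sub_iota K : {subset K <= iota 0 m} -> {subset 0 :: map S K <= iota 0 m.+1}.
  move=> sK i; rewrite inE mem_iota /= add0n => /predU1P[->//|/mapP[j /sK]].
  by rewrite mem_iota => ltj ->.
have leP : size P <= m.+1 ^ z.
  apply: IHm; rewrite ?undup_uniq // => K uK sK /shP shFK.
  rewrite -(size_map S); apply: shF shFK; first by rewrite map_inj_uniq //; apply: succn_inj.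
  by move=> i iK; apply: sub_iota sK _ _; rewrite inE iK orbT.
apply: leq_trans leF _.
have mono e : m.+1 ^ e <= m.+2 ^ e by case: e => // e; rewrite leq_exp2r.
have [B0|Bn0] := eqVneq B [::].
  by rewrite B0 addn0; apply: leq_trans leP (mono z).
(* A nonempty [B] shatters the empty set, so [F] shatters coordinate 0. *)
have z_gt0 : 0 < z.
  apply: (shF [:: 0]) => //; first by move=> i; rewrite inE => /eqP->; rewrite mem_iota.
  by apply: (shB [::]) => x; case: (B) Bn0 => // t B' _; exists t; rewrite ?mem_head.
have leB : size B <= m.+1 ^ z.-1.
  apply: IHm; first by rewrite filter_uniq ?undup_uniq.
    by move=> t; rewrite mem_filter => /andP[_ /szP].
  move=> K uK sK /shB shFK; rewrite -ltnS prednK // -(size_map S).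
  apply: shF shFK => /=; last exact: sub_iota.
  by rewrite (map_inj_uniq succn_inj) uK andbT; apply/mapP => -[].
(* The sum [(m+1)^z + (m+1)^(z-1)] equals [(m+2) (m+1)^(z-1)], at most [(m+2)^z]. *)
rewrite -(prednK z_gt0) in leP *; apply: leq_trans (leq_add leP leB) _.
by rewrite !expnS -mulSnr leq_mul2l mono orbT.
Qed.

(** * Complete tables from shattered sets *)

Lemma complete_size (s : seq (seq bool)) m : uniq s -> all (fun r => size r == m) s ->
  (forall x, size x = m -> x \in s) -> size s = 2 ^ m.
Proof.
move=> us /allP sz_s all_s.
have -> : size s = size (map val (enum {: m.-tuple bool})).
  apply/perm_size/uniq_perm; rewrite ?(map_inj_uniq val_inj) ?enum_uniq // => x.
  apply/idP/mapP => [xs | [t _ ->]]; last by rewrite all_s // size_tuple.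
  by exists (Tuple (sz_s x xs)); rewrite ?mem_enum.
by rewrite size_map -cardE card_tuple card_bool.
Qed.

Lemma size_cols_closure T Q : in_closure T Q -> size (cols Q) <= size (cols T).
Proof. by case=> D [nu [_ [_ ->]]]; rewrite /= cols_opI size_filter count_size. Qed.

(** On the columns at the positions in [K] every vector of values occurs. [K] is nonempty because
    restricting to no columns gives [Lambda], which is not complete. *)
Lemma shattered_complete A T K : closed_class A -> A T -> uniq K -> K != [::] ->
  {subset K <= iota 0 (size (cols T))} -> shatters (map fst (rows T)) K ->
  exists Q, [/\ in_closure T Q, complete Q & size (cols Q) = size K].
Proof.
move=> A_closed AT uK K_n0 sK shK.
have ltK k : k \in K -> k < size (cols T) by move/sK; rewrite mem_iota.
have /and5P[uc /allP szT _ _ _] := closed_wf A_closed AT.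
pose C := map (nth 0 (cols T)) K; pose nu (_ : seq bool) := [:: 0].
pose Q := restr T C nu.
have TQ : in_closure T Q by apply: restr_in_closure.
have /and5P[ucQ szQ urQ _ _] := closed_wf A_closed (closed_in_closure A_closed AT TQ).
have cQ : cols Q = [seq i <- cols T | i \in C] := cols_restr T C nu.
have CT : {subset C <= cols T} by move=> _ /mapP[k /ltK ltk ->]; apply: mem_nth.
have hasC : has (mem C) (cols T).
  case: K @C CT {TQ cQ Q ucQ szQ urQ uK sK shK ltK} K_n0 => // k K C CT _.
  by apply/hasP; exists (nth 0 (cols T) k); rewrite /= ?CT ?mem_head.
have szK : size (cols Q) = size K.
  rewrite -(size_map (nth 0 (cols T)) K); apply/perm_size/uniq_perm => //.
    rewrite map_inj_in_uniq // => i j /ltK lti /ltK ltj /eqP.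
    by rewrite nth_uniq // => /eqP.
  by move=> i; rewrite cQ mem_filter andb_idr // => /CT.
exists Q; split=> //; apply/eqP; rewrite -(size_map fst (rows Q)).
apply: complete_size => // [|x sz_x]; first by rewrite all_map; exact: szQ.
(* The columns of [Q] follow the order of [T], not that of [K], so [x] is read by attribute
   names. *)
pose y i := nth false x (index i (cols Q)).
have [_ /mapP[r rT ->] ry] := shK (fun k => y (nth 0 (cols T) k)).
have Dx : restr_vec T C r.1 = x.
  apply: (@eq_from_nth _ false) => [|k]; first by rewrite size_map -cQ.
  rewrite size_map => ltk; rewrite (nth_map 0) // -cQ.
  rewrite -cQ in ltk; have: nth 0 (cols Q) k \in C.
    by have := mem_nth 0 ltk; rewrite {2}cQ mem_filter => /andP[].
  case/mapP=> j jK Dj; rewrite Dj /val_at index_uniq ?ltK // ry // -Dj /y index_uniq //.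
apply/mapP; exists (x, [:: 0]) => //.
by rewrite mem_restr_rows // eqxx andbT -Dx (map_f (fun r => restr_vec T C r.1)).
Qed.

(** * Existence of the parameters of a table, and irreducible parts of covers and words *)

Lemma Z_is_ex T : exists z, Z_is T z /\
  (~~ is_empty_table T -> forall Q, in_closure T Q -> complete Q -> size (cols Q) <= z).
Proof.
rewrite /Z_is; case: (is_empty_table T); first by exists 0.
have [[Q0 [TQ0 cQ0]] | noQ] := classic (exists Q, in_closure T Q /\ complete Q).
  have [||z [Q TQ /andP[cQ /eqP Dz]] maxz] := @ex_greatest
      (fun z => exists2 Q, in_closure T Q & complete Q && (size (cols Q) == z)) (size (cols T)).
  - by exists (size (cols Q0)), Q0; rewrite ?cQ0 /=.
  - by move=> _ [Q TQ /andP[_ /eqP <-]]; apply: size_cols_closure.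
  have max Q' : in_closure T Q' -> complete Q' -> size (cols Q') <= z.
    by move=> TQ' cQ'; apply: maxz; exists Q'; rewrite ?cQ' /=.
  by exists z; split; [left; exists Q | ].
exists 0; split; first right; first split=> // Q TQ.
  by apply/negP => cQ; apply: noQ; exists Q.
by move=> _ Q TQ cQ; case: noQ; exists Q.
Qed.

Lemma irreducible_ann_size_cols T a : irreducible_ann T a -> size a <= size (cols T).
Proof.
move=> irra; have ua := irreducible_ann_uniq irra.
case: irra => -[/allP aT _ consa] _; rewrite -(size_map fst); apply: uniq_leq_size.
  rewrite map_inj_in_uniq // => -[i b] [j c] /= ib jc Dij.
  by rewrite -Dij in jc *; rewrite (consa i b c).
by move=> _ /mapP[l /aT lT ->].
Qed.

Lemma G_is_ex T : exists g, G_is T g /\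
  (~~ is_empty_table T -> forall a, irreducible_ann T a -> size a <= g).
Proof.
rewrite /G_is; case: (is_empty_table T); first by exists 0.
have [[a0 irra0] | noa] := classic (exists a, irreducible_ann T a).
  have [||g [a irra Dg] maxg] := @ex_greatest
      (fun g => exists2 a, irreducible_ann T a & size a = g) (size (cols T)).
  - by exists (size a0), a0.
  - by move=> _ [a irra <-]; apply: irreducible_ann_size_cols.
  have max b : irreducible_ann T b -> size b <= g by move=> irrb; apply: maxg; exists b.
  by exists g; split; [left; exists a | ].
exists 0; split; first right; first split=> // a irra.
  by apply: noa; exists a.
by move=> _ a irra; case: noa; exists a.
Qed.

(** Sending a row to the first word of [U] that it matches hits every word, by its private row. *)
Lemma irreducible_cover_size_rows psi T n U :
  irreducible_cover psi T n U -> size U <= size (rows T).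
Proof.
move=> irrU; have [uU _] := irrU.
pose f (r : seq bool * seq nat) := head [::] [seq a <- U | matches T r.1 a].
rewrite -(size_map f); apply: uniq_leq_size => // a aU.
have [r rT [ra only_a]] := irreducible_cover_private irrU aU.
apply/mapP; exists r => //; rewrite /f.
have: a \in [seq b <- U | matches T r.1 b] by rewrite mem_filter ra.
case Df: [seq b <- U | matches T r.1 b] => [|b s] // _ /=.
have: b \in [seq b <- U | matches T r.1 b] by rewrite Df mem_head.
by rewrite mem_filter => /andP[rb bU]; rewrite -(only_a b).
Qed.

(** The empty word alone is an irreducible cover, so the maximum exists and is positive. *)
Lemma l_is_ex psi T n : partially_bounded psi -> exists m, l_is psi T n m /\
  (~~ is_empty_table T -> 0 < m /\ forall U, irreducible_cover psi T n U -> size U <= m).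
Proof.
case=> psi0 _ _ _; rewrite /l_is; case: (boolP (is_empty_table T)) => [_|T_n0]; first by exists 0.
have irr0 : irreducible_cover psi T n [:: [::]].
  split=> //; split; first split.
  - move=> a; rewrite inE => /eqP->; split=> //; rewrite /psi_w /=.
    by have := psi0 [::]; rewrite eqxx => /eqP->.
  - by move=> r _; exists [::]; rewrite ?mem_head.
  move=> U uU sU nsU [_ covU]; apply: nsU => a; rewrite inE => /eqP->.
  move: T_n0; rewrite /is_empty_table; case DT: (rows T) => [|r rs] // _.
  have [|b bU _] := covU r; first by rewrite DT mem_head.
  by have := sU b bU; rewrite inE => /eqP <-.
have [||m [U irrU Dm] maxm] := @ex_greatest
    (fun m => exists2 U, irreducible_cover psi T n U & size U = m) (size (rows T)).
- by exists 1, [:: [::]].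
- by move=> _ [U irrU <-]; apply: irreducible_cover_size_rows irrU.
have max U' : irreducible_cover psi T n U' -> size U' <= m.
  by move=> irrU'; apply: maxm; exists U'.
by exists m; split=> [|_]; [exists U | split=> //; apply: (max [:: [::]])].
Qed.

(** A cover of least size among those inside [W] is irreducible. *)
Lemma irreducible_subcover psi T n W : Defs.cover psi T n W ->
  exists2 U, irreducible_cover psi T n U & {subset U <= W}.
Proof.
move=> covW.
have [|m [U [uU covU sUW] Dm] minm] := @ex_least
    (fun m => exists2 U, [/\ uniq U, Defs.cover psi T n U & {subset U <= W}] & size U = m).
  exists (size (undup W)), (undup W) => //; split; first exact: undup_uniq.
    case: covW => W_le W_cov; split=> [a|r /W_cov[a aW ra]]; first by rewrite mem_undup => /W_le.
    by exists a; rewrite ?mem_undup.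
  by move=> a; rewrite mem_undup.
exists U => //; split=> //; split=> // U' uU' sU' nsU covU'; apply: nsU => a.
have [|_ ->] // := uniq_min_size uU' sU'.
by rewrite Dm; apply: minm; exists U' => //; split=> // b /sU'/sUW.
Qed.

Lemma annihilating_irreducible T a : annihilating T a ->
  exists2 b, irreducible_ann T b & {subset b <= a}.
Proof.
elim: {a}_.+1 {-2}a (ltnSn (size a)) => // m IHm a lta anna.
have [[b [sba ltba annb]] | nob] :=
    classic (exists b, [/\ subseq b a, size b < size a & annihilating T b]).
  have [|c irrc scb] := IHm b _ annb; first exact: leq_trans ltba lta.
  by exists c => // l /scb; apply: mem_subseq.
by exists a => //; split=> // b sba ltba annb; apply: nob; exists b.
Qed.

Lemma good_weaken C ok b d d' v : d <= d' -> good C ok b d v -> good C ok b d' v.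
Proof.
move=> led [wfv detv atv totv okv]; split=> // p /okv[szp okp].
by split=> //; apply: leq_trans led.
Qed.

Lemma good_imp C (ok ok' : word -> nat -> Prop) d v :
  (forall b e, (forall l, l \in b -> l.1 \in C) -> ok b e -> ok' b e) ->
  good C ok [::] d v -> good C ok' [::] d v.
Proof.
move=> imp [wfv detv atv totv okv]; split=> // p p_in; have [szp okp] := okv p p_in.
by split=> //; apply: imp => // l /(path_attrs p_in)/atv.
Qed.

(** * Query rounds that halve the number of rows *)

Section Halving.
Variables (T : table) (U : seq word) (lab : word -> nat) (n g : nat).
Hypothesis g_max : forall a, irreducible_ann T a -> size a <= g.
Hypothesis U_ok : forall a, a \in U -> in_Omega T a /\ size a <= n.
Hypothesis U_cov : forall r, r \in rows T -> exists2 a, a \in U & matches T r.1 a.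

(** Rows reaching the same leaf may match different words of [U], provided these share the label
    [e]. *)
Definition solves (b : word) (e : nat) : Prop :=
  forall r, r \in rows T -> sat (val_at T r.1) b ->
    exists2 a, a \in U & lab a = e /\ matches T r.1 a.

(** An answer against a value held by at least half of the rows discards those rows. *)
Lemma size_rows_of_letter b c i m :
  (i, ~~ m) \in c -> 2 * count (fun r => val_at T r.1 i == m) (rows_of T b) >= size (rows_of T b) ->
  2 * size (rows_of T (b ++ c)) <= size (rows_of T b).
Proof.
move=> ic; set S := rows_of T b.
have le_c : size (rows_of T (b ++ c)) <= count (predC (fun r => val_at T r.1 i == m)) S.
  rewrite /S /rows_of count_filter size_filter; apply: sub_count => r /=.
  rewrite !matchesE sat_cat => /andP[-> /allP/(_ _ ic) /= /eqP->].
  by case: m {ic}.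
by have := count_predC (fun r => val_at T r.1 i == m) S; lia.
Qed.

(* Either the word of majority values is satisfied by a row, hence contains a
   member of the cover, or it contains a short annihilating word.  Query the
   attributes of that word: answers that all agree with it settle the matter,
   and any disagreement discards half of the rows. *)
Lemma halving k b : size (rows_of T b) < 2 ^ k ->
  exists v, good (cols T) solves b (k * (g + n)) v.
Proof.
elim: k b => [|k IHk] b lt_b.
  exists (Leaf 0); apply: good_leaf => r rT rb; move: lt_b; rewrite ltnS leqn0 => /nilP b0.
  by have: r \in rows_of T b by [rewrite mem_filter rT andbT]; rewrite b0.
pose maj i := size (rows_of T b) <= 2 * count (fun r => val_at T r.1 i == true) (rows_of T b).
have majP i : size (rows_of T b) <= 2 * count (fun r => val_at T r.1 i == maj i) (rows_of T b).
  case Dm: (maj i); first exact: Dm.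
  move: Dm => /negbT; rewrite /maj -ltnNge => lt_c.
  have := count_predC (fun r => val_at T r.1 i == true) (rows_of T b).
  suff -> : count (fun r => val_at T r.1 i == false) (rows_of T b) =
            count (predC (fun r => val_at T r.1 i == true)) (rows_of T b) by lia.
  by apply: eq_count => r /=; case: (val_at _ _ _).
pose w := [seq (i, maj i) | i <- cols T].
have w_maj l : l \in w -> l.2 = maj l.1 by case/mapP=> i _ ->.
have w_cols l : l \in w -> l.1 \in cols T by case/mapP=> i iT ->.
have [q [qw szq [e solve_q]]] : exists q, [/\ {subset q <= w}, size q <= g + n
    & exists e, forall c, {subset q <= c} -> solves c e].
  have [/hasP[r rT rw] | noR] := boolP (has (fun r => matches T r.1 w) (rows T)).
    have [a aU ra] := U_cov rT; have [aT sza] := U_ok aU.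
    have aw : {subset a <= w}.
      move=> l la; have lT : l.1 \in cols T := allP aT l la.
      apply/mapP; exists l.1 => //; have /eqP := allP ra l la; rewrite [l]surjective_pairing /= => <-.
      have /(allP rw)/eqP /= -> // : (l.1, maj l.1) \in w by apply: map_f (fun i => (i, maj i)) _ _ lT.
    exists a; split=> //; first by rewrite (leq_trans sza) // leq_addl.
    exists (lab a) => c sac r' r'T r'c; exists a => //; split=> //.
    exact: sat_sub sac r'c.
  have annw : annihilating T w.
    split; first by apply/allP => l /w_cols.
      by apply/eqP; rewrite -[_ == _]negbK -has_filter.
    by move=> i c d /w_maj /= -> /w_maj /= ->.
  have [q irrq qw] := annihilating_irreducible annw.
  exists q; split=> //; first by rewrite (leq_trans (g_max irrq)) // leq_addr.
  (* No row satisfies [q], so the decision 0 is never tested. *)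
  exists 0 => c sqc r rT rc; have [[_ q0 _] _] := irrq.
  have: r \in rows_of T q by rewrite mem_filter rT andbT; apply: sat_sub sqc rc.
  by rewrite q0.
have [|s sz_s|v gv] := @good_query (cols T) solves b (k * (g + n)) (map fst q).
- by move=> _ /mapP[l /qw/w_cols lT ->].
- have [/eqP Ds | neq_s] := boolP (s == map snd q).
    exists (Leaf e); apply: good_leaf; apply: solve_q => l lq.
    by rewrite mem_cat Ds zip_unzip lq orbT.
  apply: IHk.
  have [j ltj sj] : exists2 j, j < size q & nth false s j != (nth (0, false) q j).2.
    rewrite size_map in sz_s; apply: NNPP => no_j; case/eqP: neq_s.
    apply: (@eq_from_nth _ false); rewrite ?size_map // sz_s => j ltj.
    rewrite (nth_map (0, false)) //; apply/eqP; apply: contraT => sj.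
    by case: no_j; exists j.
  have lq := mem_nth (0, false) ltj; set l := nth _ q j in sj lq.
  have := @size_rows_of_letter b (zip (map fst q) s) l.1 (maj l.1) _ (majP l.1).
  have -> : (l.1, ~~ maj l.1) \in zip (map fst q) s.
    have -> : (l.1, ~~ maj l.1) = nth (0, false) (zip (map fst q) s) j.
      rewrite nth_zip ?sz_s // (nth_map (0, false)) // -/l -(w_maj l) ?qw //.
      by congr pair; move: sj; case: (l.2); case: (nth _ s j).
    by rewrite mem_nth // size_zip sz_s minnn size_map.
  by move=> /(_ isT) le_b; rewrite -(@ltn_pmul2l 2) // -expnS (leq_ltn_trans le_b).
exists v; apply: good_weaken gv; rewrite size_map mulSn leq_add2r //.
Qed.

End Halving.

(** The bound is [n] per query, times at most [g + n] queries per round, times the number of rounds;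
    the restricted table has fewer than [2 ^ ((n + c) * z).+1] rows. *)
Lemma det_upper_bound A psi n z g l c T ka kd :
  closed_class A -> bounded_measure psi ->
  (forall k, Z_set psi A n k -> k <= z) -> (forall k, G_set psi A n k -> k <= g) ->
  (forall k, L_set psi A n k -> k <= l) -> l <= 2 ^ c ->
  A T -> psi_a_is psi T ka -> ka <= n -> psi_d_is psi T kd ->
  kd <= n * (((n + c) * z).+1 * (g + n)).
Proof.
move=> A_closed psi_bounded Z_le G_le L_le le_l AT.
rewrite /psi_a_is /psi_d_is; case: (boolP (is_empty_table T)) => [_ _ _ -> //|T_n0].
move=> [[G [wfG atG covG okG] <-] _] /psi_tree_leP path_le [_ kd_min].
pose W := map fst (tree_paths G).
have pathG p i : p \in tree_paths G -> i \in p.1 -> i.1 \in cols T.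
  case/flattenP=> s sG ps ip; apply: atG; apply/flattenP.
  elim: (G : seq node) sG {wfG covG okG path_le kd_min W} => //= v G' IHG.
  rewrite inE => /predU1P[Ds | /IHG[t tG it]]; last by exists t; rewrite // inE tG orbT.
  by exists (node_attrs v); rewrite ?mem_head //; apply: path_attrs ip; rewrite -Ds.
have covW : Defs.cover psi T n W.
  split=> [_ /mapP[p pG ->] | r /covG[p pG rp]]; last by exists p.1 => //; apply: map_f.
  by split; [apply/allP => i; apply: pathG | apply: path_le].
have [U irrU sUW] := irreducible_subcover covW.
have [_ [[U_le U_cov] _]] := irrU.
(* A word may occur on several paths; the decision on the first of them is taken. *)
pose lab a := (nth ([::], 0) (tree_paths G) (index a W)).2.
have labP a r : a \in U -> r \in rows T -> matches T r.1 a -> lab a \in r.2.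
  move=> /sUW aW rT ra; have lt_a : index a W < size (tree_paths G) by rewrite -(size_map fst) index_mem.
  apply: (okG (nth ([::], 0) (tree_paths G) (index a W))); first exact: mem_nth.
  by rewrite mem_filter rT andbT -(nth_map _ [::] fst) // nth_index.
pose C := flatten (map (map fst) U).
have memC i : i \in C -> i \in cols T /\ psi [:: i] <= n.
  case/flattenP=> s /mapP[a aU ->] /mapP[j ja ->]; have [/allP aT a_le] := U_le a aU.
  by split; [apply: aT | apply: leq_trans (psi_letter psi_bounded ja) a_le].
have UC a i : a \in U -> i \in a -> i.1 \in C.
  by move=> aU ia; apply/flattenP; exists (map fst a); apply: map_f.
pose ok b e := forall r, r \in rows T -> sat (val_at T r.1) b -> e \in r.2.
have CT : {subset C <= cols T} by move=> i /memC[].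
have from_good C' d v : {subset C' <= cols T} -> {subset C' <= C} -> good C' ok [::] d v -> kd <= n * d.
  move=> C'T C'C gv; apply: leq_trans (kd_min [:: v] (good_det_tree C'T gv)) _.
  apply/psi_tree_leP => p; rewrite tree_paths1 => p_in.
  have [_ _ atv _ okv] := gv; have [le_d _] := okv p p_in.
  apply: leq_trans (psi_w_le psi_bounded (n := n) _) _.
    by move=> i /(path_attrs p_in)/atv/C'C/memC[].
  by rewrite leq_mul2l le_d orbT.
(* If no attribute occurs in [U], every row matches the empty word and one decision suits them
   all. *)
have [hasC | nohasC] := boolP (has (mem C) (cols T)); last first.
  apply: leq_trans (from_good [::] 0 (Leaf (lab [::])) _ _ _) _ => //; last by rewrite muln0.
  apply: good_leaf => r rT _.
  have [a aU ra] := U_cov r rT; case: a => [|i a] in aU ra *; first exact: labP.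
  case/hasP: nohasC; exists i.1; last by apply: UC aU (mem_head _ _).
  by apply: CT; apply: UC aU (mem_head _ _).
pose nu (_ : seq bool) := [:: 0]; pose T' := restr T C nu.
have AT' : A T' by apply: closed_in_closure AT _ => //; apply: restr_in_closure.
have wfT' := closed_wf A_closed AT'.
have cT' : cols T' = [seq i <- cols T | i \in C] := cols_restr T C nu.
have memT' i : (i \in cols T') = (i \in C).
  by rewrite cT' mem_filter; case iC: (i \in C); rewrite // CT.
have row_in r : r \in rows T -> (restr_vec T C r.1, [:: 0]) \in rows T'.
  by move=> rT; rewrite mem_restr_rows // eqxx andbT (map_f (fun r => restr_vec T C r.1)).
have satE r a : (forall i, i \in a -> i.1 \in C) ->
    sat (val_at T' (restr_vec T C r)) a = sat (val_at T r) a.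
  by move=> aC; apply: sat_restr => i /aC iC; rewrite CT.
have T'_n0: ~~ is_empty_table T'.
  move: T_n0; rewrite /is_empty_table; case Dr: (rows T) => [|r rs] // _.
  by apply: contraTneq (row_in r _) => [->|]; rewrite // Dr mem_head.
have m_le : m_psi psi T' <= n by apply/bigmax_leqP_seq => i; rewrite memT' => /memC[].
have [z' [z'P /(_ T'_n0) z'_max]] := Z_is_ex T'.
have le_z : z' <= z by apply: Z_le; exists T'.
have [g' [g'P /(_ T'_n0) g'_max]] := G_is_ex T'.
have le_g : g' <= g by apply: G_le; exists T'.
(* [U] covers [T] itself, and the bound on L concerns all tables of the class. The bounds on Z and G
   ask for [m_psi] at most [n], which is ensured for [T']. *)
have szU : size U <= 2 ^ c.
  have [[pb _] [m [mP /(_ T_n0)[_ m_max]]]] := (psi_bounded, l_is_ex T n (proj1 psi_bounded)).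
  by apply: leq_trans (m_max U irrU) (leq_trans (L_le m _) le_l); exists T.
have sz_le a : a \in U -> size a <= n.
  by case/U_le=> _; apply: leq_trans; apply: size_psi_w.
have szC : size (cols T') <= 2 ^ c * n.
  apply: (@leq_trans (size C)).
    by apply: uniq_leq_size => [|i]; [case/and5P: wfT' | rewrite memT'].
  rewrite size_flatten /shape -map_comp sumnE big_map.
  apply: (@leq_trans (\sum_(a <- U) n)); last by rewrite big_const_seq count_predT iter_addn_0 mulnC leq_mul2r szU orbT.
  by rewrite !big_seq; apply: leq_sum => a aU /=; rewrite size_map sz_le.
have szR : size (rows T') < 2 ^ ((n + c) * z).+1.
  have [uc /allP szT' ur _ _] := and5P wfT'.
  have := @sauer_shelah (size (cols T')) z (map fst (rows T')) ur.
  rewrite size_map => sh; apply: leq_ltn_trans (sh _ _) _.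
  - by move=> _ /mapP[r /szT'/eqP Dr ->].
  - move=> K uK sK shK; have [->//|K_n0] := eqVneq K [::].
    have [Q [TQ cQ <-]] := shattered_complete A_closed AT' uK K_n0 sK shK.
    by apply: leq_trans le_z; apply: z'_max.
  (* At most [2 ^ c] words of length at most [n] give the column count, and [n + 1 <= 2 ^ n] absorbs
     the factor and the successor. *)
  have le_m : (size (cols T')).+1 <= 2 ^ (n + c).
    apply: (@leq_trans (2 ^ c * n).+1); first by rewrite ltnS.
    rewrite addnC expnD; apply: (@leq_trans (2 ^ c * n.+1)).
      by rewrite mulnS -add1n leq_add2r expn_gt0.
    by rewrite leq_mul2l ltn_expl // orbT.
  rewrite expnS expnM; apply: (@leq_ltn_trans ((2 ^ (n + c)) ^ z)).
    by case: (z) => // z0; rewrite leq_exp2r.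
  by rewrite mul2n -addnn -[ltnLHS]addn0 ltn_add2l !expn_gt0.
have T'_row r' : r' \in rows T' -> exists2 r, r \in rows T & r'.1 = restr_vec T C r.1.
  by rewrite mem_restr_rows // => /andP[/mapP[r rT ->] _]; exists r.
have [||r' /T'_row[r rT Dr']||v gv] := @halving T' U lab n g _ _ _ ((n + c) * z).+1 [::].
- by move=> a /g'_max sza; apply: leq_trans sza le_g.
- move=> a aU; split; last exact: sz_le.
  by apply/allP => i ia; rewrite memT'; apply: UC aU ia.
- have [a aU ra] := U_cov r rT; exists a => //.
  by rewrite matchesE Dr' satE // => i; apply: UC.
- by rewrite /rows_of (eq_filter (a2 := xpredT)) // filter_predT.
apply: (from_good (cols T') _ v).
- by move=> i; rewrite memT' => /CT.
- by move=> i; rewrite memT'.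
apply: good_imp gv => b e bC sol r rT rb.
have [||a aU [<- ra]] := sol (restr_vec T C r.1, [:: 0]); first exact: row_in.
  by rewrite /= satE // => i /bC; rewrite memT'.
apply: labP => //; move: ra; rewrite matchesE /= satE // => i; exact: UC.
Qed.

(** * Bounds for the class functions *)

Section Bounds.
Variables (A : table -> Prop) (psi : measure_type).
Hypotheses (A_closed : closed_class A) (psi_bounded : bounded_measure psi).

Lemma m_psi_Lambda n : m_psi psi Lambda <= n.
Proof. by rewrite /m_psi big_nil. Qed.

Lemma Z_value n h : (forall k, H_set psi A (n * 4) k -> k <= h) ->
  exists2 z, value (Z_set psi A n) z & z <= h.+1 * h.+3.
Proof.
move=> H_le; apply: bounded_value.
  by exists 0, Lambda; split; rewrite ?m_psi_Lambda //; apply: Lambda_in A_closed.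
move=> k [T [AT m_le]]; rewrite /Z_is; case: ifP => [_ -> //|_].
case=> [[Q [TQ cQ <- _]] | [_ -> //]]; apply/ltnW.
apply: complete_table_size H_le _ _ _ (cQ) => //.
- exact: closed_in_closure AT TQ.
- rewrite /is_empty_table -size_eq0; move: cQ => /eqP->.
  by rewrite -lt0n expn_gt0.
(* Deleting columns cannot increase [m_psi]. *)
apply/bigmax_leqP_seq => i iQ _; have /bigmax_leqP_seq/(_ i) := m_le; apply=> //.
by case: TQ iQ => D [nu [_ [_ ->]]]; rewrite /= cols_opI mem_filter => /andP[].
Qed.

Lemma G_value n h : (forall k, H_set psi A n k -> k <= h) ->
  exists2 g, value (G_set psi A n) g & g <= h.+1.
Proof.
move=> H_le; apply: bounded_value.
  by exists 0, Lambda; split; rewrite ?m_psi_Lambda //; apply: Lambda_in A_closed.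
move=> k [T [AT m_le]]; rewrite /G_is; case: ifP => [_ -> //|/negbT T_n0].
case=> [[a [irra <- _]] | [_ -> //]].
exact: irreducible_ann_size H_le AT T_n0 m_le irra.
Qed.

Lemma L_value n h : (forall k, H_set psi A n k -> k <= h) ->
  exists2 l, value (L_set psi A n) l & l <= 2 ^ h.
Proof.
move=> H_le; apply: bounded_value.
  by exists 0, Lambda; split=> //; apply: Lambda_in A_closed.
move=> k [T [AT]]; rewrite /l_is; case: ifP => [_ -> //|/negbT T_n0 [U [irrU <- _]]].
exact: irreducible_cover_size H_le AT T_n0 irrU.
Qed.

Lemma H_value n z g l c :
  (forall k, Z_set psi A n k -> k <= z) -> (forall k, G_set psi A n k -> k <= g) ->
  (forall k, L_set psi A n k -> k <= l) -> l <= 2 ^ c ->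
  exists2 h, value (H_set psi A n) h & h <= n * (((n + c) * z).+1 * (g + n)).
Proof.
move=> Z_le G_le L_le le_l; apply: bounded_value.
  exists 0, Lambda; split=> //; first exact: Lambda_in A_closed.
  by exists 0.
move=> k [T [AT [ka psi_a le_ka] psi_d]].
exact: det_upper_bound Z_le G_le L_le le_l AT psi_a le_ka psi_d.
Qed.

Lemma L_value_gt0 n l : nontrivial A -> value (L_set psi A n) l -> 0 < l.
Proof.
case=> T [AT T_n0] lP; have [m [mP /(_ T_n0)[m_gt0 _]]] := l_is_ex T n (proj1 psi_bounded).
by apply: leq_trans m_gt0 (value_le lP _); exists T.
Qed.

End Bounds.

(** * From numerical bounds to polynomials *)

Import Order.TTheory GRing.Theory Num.Theory.
Local Open Scope ring_scope.

(** The value of an integer polynomial might be negative; as an exponent here it is not, since [l]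
    is at least 1. *)
Lemma le_rat_exp2 (l : nat) (x : int) : (0 < l)%N ->
  (l%:Q <= 2%:Q ^ x) -> exists2 c : nat, x = c%:Z & (l <= 2 ^ c)%N.
Proof.
move=> l_gt0; case: x => [c|c] le_l.
  exists c => //; move: le_l; rewrite -exprnP -[2%:Q]/(2%:R : rat) -pmulrn -natrX.
  by rewrite ler_nat.
rewrite NegzE -exprnN leNgt in le_l *; case/negP: le_l.
apply: lt_le_trans (_ : 1 <= _); last by rewrite ler1z.
by rewrite invf_lt1 ?exprn_gt0 // exprn_egt1.
Qed.

Theorem theorem4 (A : table -> Prop) (psi : measure_type) :
  closed_class A -> nontrivial A -> bounded_measure psi ->
  (forall n, defined (H_set psi A n)) ->
  ((exists p0 : {poly int}, forall n : nat,
       exists h : nat, value (H_set psi A n) h /\ (h%:Z <= p0.[n%:Z])) <->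
   (exists p1 p2 p3 : {poly int}, forall n : nat,
       [/\ exists z : nat, value (Z_set psi A n) z /\ (z%:Z <= p1.[n%:Z]),
           exists g : nat, value (G_set psi A n) g /\ (g%:Z <= p2.[n%:Z]) &
           exists l : nat, value (L_set psi A n) l /\
                           (l%:Q <= (2%:Q) ^ (p3.[n%:Z]))])).
Proof.
move=> A_closed A_nontriv psi_bounded _; split.
  (* Certificates of four letters call for H at [4 n], hence the substitution. *)
  case=> p0 p0P; pose q := p0 \Po (4%:P * 'X).
  (* These majorize the bounds [(h4 + 1) (h4 + 3)] for Z, [h + 1] for G and the exponent [h] for
     L. *)
  exists ((q + 1) * (q + 1 + 1 + 1)), (p0 + 1), p0 => n.
  have [h [hP le_h]] := p0P n; have [h4 [h4P le_h4]] := p0P (n * 4)%N.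
  split.
  - have [z zP le_z] := Z_value A_closed psi_bounded (fun k => value_le h4P).
    exists z; split=> //.
    have Dq : q.[n%:Z] = p0.[(n * 4)%N%:Z].
      by rewrite /q horner_comp !hornerE PoszM mulrC.
    rewrite hornerM !hornerD !hornerC Dq.
    apply: le_trans (_ : (h4.+1 * h4.+3)%N%:Z <= _); first by rewrite lez_nat.
    by rewrite PoszM ler_pM //; lia.
  - have [g gP le_g] := G_value A_closed psi_bounded (fun k => value_le hP).
    by exists g; split=> //; rewrite !hornerE; lia.
  have [l lP le_l] := L_value A_closed psi_bounded (fun k => value_le hP).
  exists l; split=> //.
  (* A negative value of [p0] is excluded because it is at least [h]. *)
  case: (p0.[n%:Z]) le_h => // c; rewrite lez_nat => le_hc.
  rewrite -exprnP -[2%:Q]/(2%:R : rat) -pmulrn -natrX ler_nat.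
  by rewrite (leq_trans le_l) // leq_exp2l.
case=> p1 [p2 [p3 pP]].
(* The bound of [H_value] with [z], [g], [c] replaced by [p1], [p2], [p3]. *)
exists ('X * ((('X + p3) * p1 + 1) * (p2 + 'X))) => n.
have [[z [zP le_z]] [g [gP le_g]] [l [lP le_l]]] := pP n.
have [c Dc le_lc] := le_rat_exp2 (L_value_gt0 psi_bounded A_nontriv lP) le_l.
have [h hP le_h] := H_value A_closed psi_bounded (fun k => value_le zP)
   (fun k => value_le gP) (fun k => value_le lP) le_lc.
exists h; split=> //; rewrite !(hornerM, hornerD, hornerX, hornerC) Dc.
apply: le_trans (_ : (n * (((n + c) * z).+1 * (g + n)))%N%:Z <= _); first by rewrite lez_nat.
rewrite PoszM ler_wpM2l // PoszM ler_pM //; last by rewrite PoszD lerD.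
by rewrite -addn1 PoszD PoszM lerD2r ler_wpM2l // PoszD.
Qed.
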